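(* Let $n$ be a positive integer and $\theta\in\mathbb{R}$, and let $f=h+\overline{g}\in K_H^O$ with $h(z)+g(z)=\frac{z}{1-z}$ and dilatation $\omega(z)=\frac{g'(z)}{h'(z)}=e^{i\theta}z^n$ for $z\in\mathbb{D}$. If $n=1$ or $n=2$, then $f_0*f\in S_H^O$ and $f_0*f$ is convex in the direction of the real axis.
   Context: $\mathbb{D}$ is the open unit disk in $\mathbb{C}$. A complex-valued harmonic function $f$ on $\mathbb{D}$ with $f(0)=0$ is written $f=h+\overline{g}$ with $h,g$ analytic in $\mathbb{D}$ and $h(0)=g(0)=0$. $S_H^O$ is the class of complex-valued, harmonic, sense-preserving, univalent functions $f$ on $\mathbb{D}$ with $f(0)=0$, $f_z(0)=1$, $f_{\overline z}(0)=0$ (i.e. $h'(0)=1$, $g'(0)=0$). $K_H^O$ is the subclass of those $f\in S_H^O$ mapping $\mathbb{D}$ onto convex domains. The canonical harmonic right half-plane mapping is $$f_0(z)=h_0(z)+\overline{g_0(z)}=\frac{z-\frac12z^2}{(1-z)^2}-\overline{\frac{\frac12z^2}{(1-z)^2}}.$$ Harmonic convolution: if $f=h+\overline{g}$ and $F=H+\overline{G}$, then $f*F=h*H+\overline{g*G}$, where for analytic functions $\left(\sum_{n\ge1} a_nz^n\right)*\left(\sum_{n\ge1} A_nz^n\right)=\sum_{n\ge1} a_nA_nz^n$. A univalent function on $\mathbb{D}$ is convex in the direction of the real axis if every line parallel to the real axis has connected or empty intersection with its image. *)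

(* Defs.v *)
From Stdlib Require Import Reals Factorial.
From Coquelicot Require Import Coquelicot.

Open Scope R_scope.

Definition disk (z : C) : Prop := Cmod z < 1.

(** Functions on the disk are total functions [C -> C] of which only the
    values on [disk] matter; derivatives at points of the (open) disk do not
    depend on the values outside it. *)

Definition analytic (h : C -> C) : Prop :=
  forall z : C, disk z -> @ex_derive C_AbsRing C_NormedModule h z.

Definition re_part (f : C -> C) (x y : R) : R := Re (f (x, y)).
Definition im_part (f : C -> C) (x y : R) : R := Im (f (x, y)).

Definition laplacian (u : R -> R -> R) (x y : R) : R :=
  partial_derive 2 0 u x y + partial_derive 0 2 u x y.

(** [ex_diff_n u 2] at every point of the open disk says that [u] is of
    class C^2 there. *)
Definition harmonic (f : C -> C) : Prop :=
  forall x y : R, disk (x, y) ->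
    ex_diff_n (re_part f) 2 x y /\ ex_diff_n (im_part f) 2 x y /\
    laplacian (re_part f) x y = 0 /\ laplacian (im_part f) x y = 0.

Definition d_x (f : C -> C) (z : C) : C :=
  (Derive (fun t => re_part f t (Im z)) (Re z),
   Derive (fun t => im_part f t (Im z)) (Re z)).
Definition d_y (f : C -> C) (z : C) : C :=
  (Derive (fun t => re_part f (Re z) t) (Im z),
   Derive (fun t => im_part f (Re z) t) (Im z)).

Definition d_z (f : C -> C) (z : C) : C :=
  ((d_x f z - Ci * d_y f z) / 2)%C.
Definition d_zbar (f : C -> C) (z : C) : C :=
  ((d_x f z + Ci * d_y f z) / 2)%C.

Definition jacobian (f : C -> C) (z : C) : R :=
  Re (d_x f z) * Im (d_y f z) - Re (d_y f z) * Im (d_x f z).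

Definition sense_preserving (f : C -> C) : Prop :=
  forall z : C, disk z -> 0 < jacobian f z.

Definition univalent (f : C -> C) : Prop :=
  forall z w : C, disk z -> disk w -> f z = f w -> z = w.

Definition image (f : C -> C) (w : C) : Prop :=
  exists z : C, disk z /\ f z = w.

Definition connected (A : C -> Prop) : Prop :=
  ~ exists U V : C -> Prop,
      open U /\ open V /\
      (forall w, A w -> U w \/ V w) /\
      (exists w, A w /\ U w) /\ (exists w, A w /\ V w) /\
      (forall w, A w -> ~ (U w /\ V w)).

Definition convex (A : C -> Prop) : Prop :=
  forall (v w : C) (t : R), A v -> A w -> 0 <= t <= 1 ->
    A ((1 - t)%R * v + t * w)%C.

Definition domain (A : C -> Prop) : Prop :=
  open A /\ (exists w, A w) /\ connected A.

Definition SHO (f : C -> C) : Prop :=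
  harmonic f /\ sense_preserving f /\ univalent f /\
  f 0%C = 0%C /\ d_z f 0%C = 1%C /\ d_zbar f 0%C = 0%C.

Definition KHO (f : C -> C) : Prop :=
  SHO f /\ domain (image f) /\ convex (image f).

(** [connected] holds of the empty set. *)
Definition convex_in_real_direction (f : C -> C) : Prop :=
  univalent f /\
  forall c : R, connected (fun w => image f w /\ Im w = c).

(** The canonical representation f = h + conj g of a harmonic function
    vanishing at the origin. *)
Definition canonical_rep (f h g : C -> C) : Prop :=
  analytic h /\ analytic g /\ h 0%C = 0%C /\ g 0%C = 0%C /\
  forall z : C, disk z -> f z = (h z + Cconj (g z))%C.

Fixpoint C_derive_n (h : C -> C) (n : nat) : C -> C :=
  match n with
  | O => h
  | S m => C_derive (C_derive_n h m)
  end.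

Definition taylor_coef (h : C -> C) (n : nat) : C :=
  (C_derive_n h n 0 / RtoC (INR (fact n)))%C.

Definition C_Series (a : nat -> C) : C :=
  (Series (fun n => Re (a n)), Series (fun n => Im (a n))).

(** Hadamard product of the Taylor series at 0 of two analytic functions
    vanishing at 0; the series starts at exponent 1. *)
Definition conv (h H : C -> C) (z : C) : C :=
  C_Series (fun n =>
    (taylor_coef h (S n) * taylor_coef H (S n) * z ^ (S n))%C).

(** f * F for f = h + conj g and F = H + conj G, given by their canonical
    representations. *)
Definition harmonic_conv (h g H G : C -> C) (z : C) : C :=
  (conv h H z + Cconj (conv g G z))%C.

(** The canonical representation of the right half-plane mapping
    f_0 = h0 + conj g0. *)
Definition h0 (z : C) : C := ((z - z ^ 2 / 2) / (1 - z) ^ 2)%C.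
Definition g0 (z : C) : C := (- ((z ^ 2 / 2) / (1 - z) ^ 2))%C.

Definition expi (theta : R) : C := (cos theta, sin theta).

(* Main.v *)
Require Import Defs.
From Stdlib Require Import Reals Lra Lia Psatz Factorial.
From Stdlib Require Import ClassicalEpsilon FunctionalExtensionality PropExtensionality.
From Coquelicot Require Import Coquelicot.

(** Write f_0 * f = H + conj G; then H = (h + z h')/2 and G = (g - z g')/2.
    Put u = z/(1-z), which maps the disk onto the half plane Re u > -1/2. Since
    h' + g' = (1-z)^(-2), one finds d(H-G)/du = 1/(1+w) + u with w the
    dilatation of f, so its real part is at least Re u + 1/2. Hence
    Im (f_0 * f) = Im (H-G) increases from -oo to +oo along every vertical line
    of the half plane, each of its level sets is a graph y = Y(x) over
    (-1/2, oo), and along this graph Re (f_0 * f) has derivative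
    (positive factor) * (|H'|^2 - |G'|^2). When |G'| < |H'| it is therefore
    strictly increasing, which gives univalence and connected horizontal slices
    at once. The inequality |G'| < |H'| is a Schur-Cohn estimate for n = 1; for
    n = 2 the dilatation of f_0 * f is -w.

    The Hadamard products are computed from the power series of h, which is
    obtained from h' = 1/((1 + w)(1-z)^2) by expanding the factors 1/(1 - cz)
    and integrating termwise; the Cauchy formula is
    not used. *)

(** * Complex derivatives *)

(** The formulas for H and G are partial fractions: [h0] and [g0] are half the sum and half the
    difference of z/(1-z), the unit of the Hadamard product, and z/(1-z)^2, which acts as F -> z F'.
    In H' - G' the second derivatives survive only through (h' + g')', a known function; hence the
    monotonicity of Im (H - G) asks nothing of w but |w| < 1. The size of n matters for |G'| < |H'|
    and for splitting 1 + w into linear factors. The variable u straightens the domain: the shear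
    argument needs whole vertical lines, on which a positive lower bound of the derivative forces
    all real values. The function Y is only chosen point by point, so its regularity has to be
    recovered from this same lower bound. [conv] speaks of iterated derivatives at 0 and of sums of
    series, while h is given as a complex differentiable function; so a series must be produced
    first and its coefficients identified afterwards. *)

Lemma Re_minus (a b : C) : Re (a - b)%C = Re a - Re b.
Proof. reflexivity. Qed.

(** Two normed module structures on [C] occur: [analytic] uses [C_NormedModule], while products and
    inner functions of compositions live over [AbsRing_NormedModule C_AbsRing]. This form is neutral
    between them. *)
Definition Cdiff (F : C -> C) (z l : C) : Prop :=
  forall eps : R, 0 < eps -> exists d : R, 0 < d /\
    forall w : C, Cmod (w - z) < d ->
      Cmod (F w - F z - l * (w - z))%C <= eps * Cmod (w - z).

Ltac Cdiff_is_derive_tac F z l :=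
  split;
  [ intros H; split; [apply is_linear_scal_l|];
    intros x Hx eps;
    assert (Ex : z = x) by
      (apply (@is_filter_lim_locally_unique C_AbsRing (AbsRing_NormedModule C_AbsRing)); exact Hx);
    subst x;
    destruct (H eps (cond_pos eps)) as [d [Hd Hw]];
    exists (mkposreal d Hd); intros w Hball;
    specialize (Hw w Hball);
    unfold norm, minus, plus, opp, scal; simpl; unfold mult; simpl;
    replace (F w + - F z + - ((w + - z) * l))%C with (F w - F z - l * (w - z))%C by ring;
    exact Hw
  | intros [_ H] eps Heps;
    destruct (H z (fun P HP => HP) (mkposreal eps Heps)) as [d Hd];
    exists d; split; [apply cond_pos|]; intros w Hw;
    specialize (Hd w Hw);
    unfold norm, minus, plus, opp, scal in Hd; simpl in Hd; unfold mult in Hd; simpl in Hd;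
    replace (F w - F z - l * (w - z))%C with (F w + - F z + - ((w + - z) * l))%C by ring;
    exact Hd ].

Lemma Cdiff_is_derive (F : C -> C) (z l : C) :
  Cdiff F z l <-> @is_derive C_AbsRing C_NormedModule F z l.
Proof. Cdiff_is_derive_tac F z l. Qed.

Lemma Cdiff_is_derive_ring (F : C -> C) (z l : C) :
  Cdiff F z l <-> @is_derive C_AbsRing (AbsRing_NormedModule C_AbsRing) F z l.
Proof. Cdiff_is_derive_tac F z l. Qed.

Lemma Cdiff_C_derive (F : C -> C) (z l : C) : Cdiff F z l -> C_derive F z = l.
Proof. intros H. apply is_C_derive_unique. apply Cdiff_is_derive in H. exact H. Qed.

Lemma Cdiff_unique (F : C -> C) (z l m : C) : Cdiff F z l -> Cdiff F z m -> l = m.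
Proof. intros H1 H2. rewrite <- (Cdiff_C_derive F z l H1). now apply Cdiff_C_derive. Qed.

Lemma analytic_Cdiff (F : C -> C) (z : C) : analytic F -> disk z -> Cdiff F z (C_derive F z).
Proof.
intros HF Hz. destruct (HF z Hz) as [l Hl].
apply Cdiff_is_derive in Hl. now rewrite (Cdiff_C_derive F z l Hl).
Qed.

Lemma Cdiff_ext_loc (F G : C -> C) (z l : C) (r : R) :
  0 < r -> (forall w, Cmod (w - z) < r -> F w = G w) -> Cdiff F z l -> Cdiff G z l.
Proof.
intros Hr He H eps Heps. destruct (H eps Heps) as [d [Hd Hw]].
exists (Rmin d r); split; [now apply Rmin_pos|]. intros w Hwd.
rewrite <- (He w), <- (He z).
- apply Hw. eapply Rlt_le_trans; [exact Hwd|apply Rmin_l].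
- replace (z - z)%C with (RtoC 0) by ring. now rewrite Cmod_0.
- eapply Rlt_le_trans; [exact Hwd|apply Rmin_r].
Qed.

Lemma disk_nbhd (z w : C) : Cmod (w - z) < 1 - Cmod z -> disk w.
Proof.
intros H. unfold disk. replace w with ((w - z) + z)%C by ring.
eapply Rle_lt_trans; [apply Cmod_triangle|]. lra.
Qed.

Lemma Cdiff_ext_disk (F G : C -> C) (z l : C) :
  (forall w, disk w -> F w = G w) -> disk z -> Cdiff F z l -> Cdiff G z l.
Proof.
intros He Hz. apply Cdiff_ext_loc with (1 - Cmod z); [unfold disk in Hz; lra|].
intros w Hw. apply He. now apply disk_nbhd with z.
Qed.

Lemma Cdiff_const (c z : C) : Cdiff (fun _ => c) z 0%C.
Proof.
intros eps Heps. exists 1; split; [lra|]. intros w _.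
replace (c - c - 0 * (w - z))%C with (RtoC 0) by ring. rewrite Cmod_0.
apply Rmult_le_pos; [lra|apply Cmod_ge_0].
Qed.

Lemma Cdiff_id (z : C) : Cdiff (fun w => w) z 1%C.
Proof.
intros eps Heps. exists 1; split; [lra|]. intros w _.
replace (w - z - 1 * (w - z))%C with (RtoC 0) by ring. rewrite Cmod_0.
apply Rmult_le_pos; [lra|apply Cmod_ge_0].
Qed.

Lemma Cdiff_plus (F G : C -> C) (z l m : C) :
  Cdiff F z l -> Cdiff G z m -> Cdiff (fun w => F w + G w)%C z (l + m)%C.
Proof.
intros HF HG. apply Cdiff_is_derive in HF, HG. apply Cdiff_is_derive.
apply (@is_derive_plus C_AbsRing C_NormedModule F G z l m HF HG).
Qed.

Lemma Cdiff_mult (F G : C -> C) (z l m : C) :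
  Cdiff F z l -> Cdiff G z m -> Cdiff (fun w => F w * G w)%C z (l * G z + F z * m)%C.
Proof.
intros HF HG. apply Cdiff_is_derive_ring in HF, HG. apply Cdiff_is_derive_ring.
apply (@is_derive_mult C_AbsRing F G z l m HF HG). exact Cmult_comm.
Qed.

Lemma Cdiff_scal (c : C) (F : C -> C) (z l : C) :
  Cdiff F z l -> Cdiff (fun w => c * F w)%C z (c * l)%C.
Proof.
intros H. replace (c * l)%C with (0 * F z + c * l)%C by ring.
apply (Cdiff_mult (fun _ => c) F); [apply Cdiff_const|exact H].
Qed.

Lemma Cdiff_comp (F G : C -> C) (z l m : C) :
  Cdiff F (G z) l -> Cdiff G z m -> Cdiff (fun w => F (G w)) z (l * m)%C.
Proof.
intros HF HG. apply Cdiff_is_derive in HF. apply Cdiff_is_derive_ring in HG. apply Cdiff_is_derive.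
rewrite Cmult_comm.
apply (@is_derive_comp C_AbsRing C_NormedModule F G z l m HF HG).
Qed.

Lemma Cdiff_inv (z : C) : z <> 0%C -> Cdiff Cinv z (- (/ (z * z)))%C.
Proof.
intros Hz eps Heps.
assert (Hp : 0 < Cmod z) by now apply Cmod_gt_0.
assert (Hp3 : 0 < Cmod z * Cmod z * Cmod z) by (repeat apply Rmult_lt_0_compat; lra).
exists (Rmin (Cmod z / 2) (eps * (Cmod z * Cmod z * Cmod z) / 2)). split.
{ apply Rmin_pos; [lra|]. apply Rdiv_lt_0_compat; [apply Rmult_lt_0_compat; lra|lra]. }
intros w Hw.
assert (H1 : Cmod (w - z) < Cmod z / 2) by (eapply Rlt_le_trans; [exact Hw|apply Rmin_l]).
assert (H2 : Cmod (w - z) < eps * (Cmod z * Cmod z * Cmod z) / 2)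
  by (eapply Rlt_le_trans; [exact Hw|apply Rmin_r]).
assert (Hwz : Cmod z / 2 <= Cmod w).
{ assert (T := Cmod_triangle (w) (z - w)%C).
  replace (w + (z - w))%C with z in T by ring.
  replace (z - w)%C with (- (w - z))%C in T by ring. rewrite Cmod_opp in T. lra. }
assert (Hw0 : w <> 0%C) by (apply Cmod_gt_0; lra).
replace (/ w - / z - - / (z * z) * (w - z))%C with ((w - z) * ((w - z) / (w * z * z)))%C
  by (field; auto).
rewrite Cmod_mult, Rmult_comm. apply Rmult_le_compat_r; [apply Cmod_ge_0|].
rewrite Cmod_div by (apply Cmod_gt_0; rewrite !Cmod_mult; repeat apply Rmult_lt_0_compat; lra).
rewrite !Cmod_mult.
assert (0 < Cmod w * Cmod z * Cmod z) by (repeat apply Rmult_lt_0_compat; lra).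
apply Rmult_le_reg_r with (Cmod w * Cmod z * Cmod z); [assumption|].
unfold Rdiv. rewrite Rmult_assoc, Rinv_l, Rmult_1_r by lra.
assert (eps * (Cmod z / 2 * Cmod z * Cmod z) <= eps * (Cmod w * Cmod z * Cmod z)).
{ apply Rmult_le_compat_l; [lra|]. repeat apply Rmult_le_compat_r; try lra. }
lra.
Qed.

Lemma Cdiff_bounded (F : C -> C) (z l : C) :
  Cdiff F z l -> exists d, 0 < d /\
    forall w, Cmod (w - z) < d -> Cmod (F w - F z)%C <= (Cmod l + 1) * Cmod (w - z).
Proof.
intros H. destruct (H 1 Rlt_0_1) as [d [Hd Hw]]. exists d; split; [exact Hd|].
intros w H1. specialize (Hw w H1).
replace (F w - F z)%C with ((F w - F z - l * (w - z)) + l * (w - z))%C by ring.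
eapply Rle_trans; [apply Cmod_triangle|]. rewrite Cmod_mult. lra.
Qed.

Lemma is_derive_eps (f : R -> R) (x l : R) :
  (forall eps, 0 < eps -> exists d, 0 < d /\
     forall y, Rabs (y - x) < d -> Rabs (f y - f x - l * (y - x)) <= eps * Rabs (y - x)) ->
  is_derive f x l.
Proof.
intros H; split; [apply is_linear_scal_l|].
intros x' Hx eps.
assert (Ex : x = x').
{ apply (@is_filter_lim_locally_unique R_AbsRing (AbsRing_NormedModule R_AbsRing)); exact Hx. }
subst x'.
destruct (H eps (cond_pos eps)) as [d [Hd Hw]].
exists (mkposreal d Hd); intros w Hball.
specialize (Hw w Hball).
unfold norm, minus, plus, opp, scal; simpl. unfold mult, abs; simpl.
replace (f w + - f x + - ((w + - x) * l)) with (f w - f x - l * (w - x)) by ring.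
exact Hw.
Qed.

Lemma is_derive_Re_line (F : C -> C) (p v l : C) (t : R) :
  Cdiff F (p + t * v)%C l -> is_derive (fun s : R => Re (F (p + s * v)%C)) t (Re (l * v)%C).
Proof.
intros H. apply is_derive_eps. intros eps Heps.
assert (Hv := Cmod_ge_0 v).
destruct (H (eps / (Cmod v + 1))) as [d [Hd Hw]]; [apply Rdiv_lt_0_compat; lra|].
exists (d / (Cmod v + 1)); split; [apply Rdiv_lt_0_compat; lra|].
intros s Hs.
assert (E : ((p + s * v) - (p + t * v))%C = (RtoC (s - t) * v)%C)
  by (rewrite RtoC_minus; ring).
assert (Em : Cmod ((p + s * v) - (p + t * v))%C = Rabs (s - t) * Cmod v)
  by (rewrite E, Cmod_mult, Cmod_R; reflexivity).
assert (Hlt : Rabs (s - t) * (Cmod v + 1) < d).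
{ apply Rmult_lt_reg_r with (/ (Cmod v + 1)); [apply Rinv_0_lt_compat; lra|].
  rewrite Rmult_assoc, Rinv_r by lra. unfold Rdiv in Hs. lra. }
assert (Ha := Rabs_pos (s - t)).
assert (Hb : Rabs (s - t) * Cmod v <= Rabs (s - t) * (Cmod v + 1)) by (apply Rmult_le_compat_l; lra).
specialize (Hw (p + s * v)%C). rewrite Em in Hw. specialize (Hw ltac:(lra)).
rewrite E in Hw.
eapply Rle_trans.
2:{ eapply Rle_trans; [exact Hw|].
  replace (eps / (Cmod v + 1) * (Rabs (s - t) * Cmod v))
    with (eps * (/ (Cmod v + 1) * (Rabs (s - t) * Cmod v))) by (unfold Rdiv; ring).
  apply Rmult_le_compat_l; [lra|].
  apply Rmult_le_reg_l with (Cmod v + 1); [lra|].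
  rewrite <- Rmult_assoc, Rinv_r by lra. lra. }
eapply Rle_trans; [|apply re_le_Cmod].
apply Req_le, f_equal. rewrite !Re_minus.
replace (l * (RtoC (s - t) * v))%C with (RtoC (s - t) * (l * v))%C by ring.
replace (Re (RtoC (s - t) * (l * v))%C) with ((s - t) * Re (l * v)%C); [ring|].
unfold Re; simpl; ring.
Qed.

(** * Shearing over a half plane *)

Lemma Cdiff_partials (F : C -> C) (x y : R) (l : C) :
  Cdiff F (x, y) l ->
  is_derive (fun t => Re (F (t, y))) x (Re l) /\
  is_derive (fun t => Re (F (x, t))) y (- Im l) /\
  is_derive (fun t => Im (F (t, y))) x (Im l) /\
  is_derive (fun t => Im (F (x, t))) y (Re l).
Proof.
intros H.
assert (Ex : forall t : R, (RtoC 0 + (0, y) + t * 1)%C = (t, y)).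
{ intros t. apply injective_projections; simpl; ring. }
assert (Ey : forall t : R, ((x, 0) + t * Ci)%C = (x, t)).
{ intros t. apply injective_projections; simpl; ring. }
(* Im w = Re (-i w) reduces the imaginary part to the real one. *)
assert (HI : Cdiff (fun w => (- Ci) * F w)%C (x, y) (- Ci * l)%C).
{ now apply Cdiff_scal. }
assert (EI : forall w : C, Re (- Ci * w)%C = Im w).
{ intros w. unfold Re, Im; simpl; ring. }
assert (Dx : forall G m, Cdiff G (x, y) m -> is_derive (fun t => Re (G (t, y))) x (Re m)).
{ intros G m HG. rewrite <- (Ex x) in HG. apply is_derive_Re_line in HG.
  rewrite Cmult_1_r in HG.
  eapply is_derive_ext; [|exact HG]. intros t; cbv beta. now rewrite (Ex t). }
assert (Dy : forall G m, Cdiff G (x, y) m -> is_derive (fun t => Re (G (x, t))) y (- Im m)).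
{ intros G m HG. rewrite <- (Ey y) in HG. apply is_derive_Re_line in HG.
  rewrite re_mult_Ci in HG.
  eapply is_derive_ext; [|exact HG]. intros t; cbv beta. now rewrite (Ey t). }
split; [apply (Dx F l H)|]. split; [apply (Dy F l H)|]. split.
- specialize (Dx _ _ HI). rewrite EI in Dx.
  eapply is_derive_ext; [|exact Dx]. intros t; apply EI.
- specialize (Dy _ _ HI). replace (Re l) with (- Im (- Ci * l)%C) by (unfold Re, Im; simpl; ring).
  eapply is_derive_ext; [|exact Dy]. intros t; apply EI.
Qed.

Lemma growth_of_derive_ge (v v' : R -> R) (m y1 y2 : R) :
  (forall y, is_derive v y (v' y)) -> (forall y, m <= v' y) -> y1 <= y2 ->
  m * (y2 - y1) <= v y2 - v y1.
Proof.
intros Hv Hm Hy.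
destruct (MVT_gen v y1 y2 v') as [c [_ Hc]].
- intros; apply Hv.
- intros x _. apply derivable_continuous_pt. exists (v' x). now apply is_derive_Reals.
- rewrite Hc. apply Rmult_le_compat_r; [lra|apply Hm].
Qed.

Lemma growth_of_derive_ge_abs (v v' : R -> R) (m y1 y2 : R) :
  0 <= m -> (forall y, is_derive v y (v' y)) -> (forall y, m <= v' y) ->
  m * Rabs (y2 - y1) <= Rabs (v y2 - v y1).
Proof.
intros Hm0 Hv Hm.
destruct (Rle_or_lt y1 y2) as [H|H].
- assert (G := growth_of_derive_ge v v' m y1 y2 Hv Hm H).
  rewrite (Rabs_pos_eq (y2 - y1)) by lra. eapply Rle_trans; [exact G|apply Rle_abs].
- assert (G := growth_of_derive_ge v v' m y2 y1 Hv Hm ltac:(lra)).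
  rewrite (Rabs_minus_sym y2), (Rabs_minus_sym (v y2)), (Rabs_pos_eq (y1 - y2)) by lra.
  eapply Rle_trans; [exact G|apply Rle_abs].
Qed.

Lemma surjective_of_derive_ge (v v' : R -> R) (m c : R) :
  0 < m -> (forall y, is_derive v y (v' y)) -> (forall y, m <= v' y) -> exists y, v y = c.
Proof.
intros Hm0 Hv Hm.
assert (Hcont : continuity v).
{ intros x. apply derivable_continuous_pt. exists (v' x). now apply is_derive_Reals. }
(* The line of slope [m] through (0, v 0) takes the value [c] at [y0]; [v] is at least as steep, so
   [c] lies between v 0 and v y0. *)
set (y0 := (c - v 0) / m).
assert (E : m * y0 = c - v 0) by (unfold y0; field; lra).
destruct (IVT_gen v 0 y0 c Hcont) as [y [_ Hy]]; [|now exists y].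
destruct (Rle_or_lt 0 y0) as [H|H].
- assert (G := growth_of_derive_ge v v' m 0 y0 Hv Hm H).
  assert (0 <= m * y0) by (apply Rmult_le_pos; lra).
  split; [eapply Rle_trans; [apply Rmin_l|]|eapply Rle_trans; [|apply Rmax_r]]; lra.
- assert (G := growth_of_derive_ge v v' m y0 0 Hv Hm ltac:(lra)).
  assert (0 < m * (- y0)) by (apply Rmult_lt_0_compat; lra).
  split; [eapply Rle_trans; [apply Rmin_r|]|eapply Rle_trans; [|apply Rmax_l]]; lra.
Qed.

Definition level_curve (P : C -> C) (a c : R) (Y : R -> R) : Prop :=
  forall x, a < x -> Im (P (x, Y x)) = c.

Lemma Cmod_le_Rabs_plus (x y : R) : Cmod (x, y) <= Rabs x + Rabs y.
Proof.
replace ((x, y) : C) with (RtoC x + RtoC y * Ci)%C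
  by (apply injective_projections; simpl; ring).
eapply Rle_trans; [apply Cmod_triangle|].
rewrite Cmod_mult, !Cmod_R, Cmod_Ci. lra.
Qed.

Lemma Rabs_im_le_Cmod (z : C) : Rabs (Im z) <= Cmod z.
Proof. eapply Rle_trans; [apply Rmax_r|apply Rmax_Cmod]. Qed.

(** The step from (x0, Y x0) sideways to (x, Y x0) changes Im P by at most L |x - x0|. The vertical
    step back to the level undoes this change, and Im P grows there at rate at least m, half the
    distance from x0 to the boundary; so its length is at most (L/m) |x - x0|. *)
Lemma level_curve_lipschitz (P P' : C -> C) (a c : R) (Y : R -> R) (x0 : R) :
  (forall u, a < Re u -> Cdiff P u (P' u)) ->
  (forall u, a < Re u -> Re u - a <= Re (P' u)) ->
  level_curve P a c Y -> a < x0 ->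
  exists K d, 0 < K /\ 0 < d /\
    forall x, Rabs (x - x0) < d -> a < x /\ Rabs (Y x - Y x0) <= K * Rabs (x - x0).
Proof.
intros HP Hm HY Hx0.
destruct (Cdiff_bounded P (x0, Y x0) _ (HP (x0, Y x0) Hx0)) as [d [Hd Hb]].
set (L := Cmod (P' (x0, Y x0)) + 1) in *.
assert (HL : 0 < L) by (unfold L; assert (T := Cmod_ge_0 (P' (x0, Y x0))); lra).
set (m := (x0 - a) / 2). assert (Hm0 : 0 < m) by (unfold m; lra).
exists (L / m), (Rmin d m).
split; [now apply Rdiv_lt_0_compat|]. split; [now apply Rmin_pos|].
intros x Hx.
assert (Hx1 : Rabs (x - x0) < d) by (eapply Rlt_le_trans; [exact Hx|apply Rmin_l]).
assert (Hx2 : Rabs (x - x0) < m) by (eapply Rlt_le_trans; [exact Hx|apply Rmin_r]).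
apply Rabs_def2 in Hx2. unfold m in Hx2.
assert (Hax : a < x) by lra. split; [exact Hax|].
assert (E : ((x, Y x0) - (x0, Y x0))%C = RtoC (x - x0))
  by (apply injective_projections; simpl; ring).
specialize (Hb (x, Y x0)). rewrite E, Cmod_R in Hb. specialize (Hb Hx1).
assert (G := growth_of_derive_ge_abs (fun y => Im (P (x, y))) (fun y => Re (P' (x, y))) m (Y x0) (Y x)
  ltac:(lra)).
cbv beta in G. rewrite (HY x Hax), <- (HY x0 Hx0) in G.
assert (G' : m * Rabs (Y x - Y x0) <= L * Rabs (x - x0)).
{ eapply Rle_trans; [apply G|].
  - intros y. apply (Cdiff_partials P x y (P' (x, y))). now apply HP.
  - intros y. eapply Rle_trans; [|apply (Hm (x, y) Hax)]. simpl. unfold m; lra.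
  - rewrite Rabs_minus_sym. eapply Rle_trans; [|exact Hb].
    eapply Rle_trans; [|apply Rabs_im_le_Cmod]. apply Req_le. reflexivity. }
apply Rmult_le_reg_l with m; [exact Hm0|].
replace (m * (L / m * Rabs (x - x0))) with (L * Rabs (x - x0)) by (field; lra). exact G'.
Qed.

(* Along the curve [Im (P' du) = 0] to first order, so [du] is proportional to [Cconj P']. *)
Lemma is_derive_along_level (P P' Q Q' : C -> C) (a c : R) (Y : R -> R) (x0 : R) :
  (forall u, a < Re u -> Cdiff P u (P' u)) ->
  (forall u, a < Re u -> Cdiff Q u (Q' u)) ->
  (forall u, a < Re u -> Re u - a <= Re (P' u)) ->
  level_curve P a c Y -> a < x0 ->
  is_derive (fun x => Re (Q (x, Y x))) x0
    (Re (Q' (x0, Y x0) * Cconj (P' (x0, Y x0)))%C / Re (P' (x0, Y x0))).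
Proof.
intros HP HQ Hm HY Hx0.
assert (Hp := HP (x0, Y x0) Hx0). assert (Hq := HQ (x0, Y x0) Hx0).
assert (Hpos := Hm (x0, Y x0) Hx0). simpl in Hpos.
destruct (level_curve_lipschitz P P' a c Y x0 HP Hm HY Hx0) as [K [d0 [HK [Hd0 HYl]]]].
set (p := P' (x0, Y x0)) in *. set (q := Q' (x0, Y x0)) in *.
assert (Hp0 : 0 < Re p) by lra.
(* The multiplier that eliminates dy: the remainder [A1] contributes - Re p dy to its imaginary
   part, and [A2] contributes Im q dy to its real part. Thus Y need only be Lipschitz at x0, and [e]
   shares [eps] between the two remainders, each measured against |(dx, dy)| <= (1 + K) |dx|. *)
set (s := Im q / Re p).
apply is_derive_eps. intros eps Heps.
set (e := eps / ((1 + Rabs s) * (1 + K))).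
assert (Hs := Rabs_pos s).
assert (HsK : 0 < (1 + Rabs s) * (1 + K)) by (apply Rmult_lt_0_compat; lra).
assert (He : 0 < e) by (unfold e; now apply Rdiv_lt_0_compat).
destruct (Hp e He) as [d1 [Hd1 H1]]. destruct (Hq e He) as [d2 [Hd2 H2]].
assert (HK1 : 0 < 1 + K) by lra.
exists (Rmin d0 (Rmin d1 d2 / (1 + K))). split.
{ apply Rmin_pos; [exact Hd0|]. apply Rdiv_lt_0_compat; [now apply Rmin_pos|exact HK1]. }
intros x Hx.
assert (Hxa : Rabs (x - x0) < d0) by (eapply Rlt_le_trans; [exact Hx|apply Rmin_l]).
destruct (HYl x Hxa) as [Hax Hlip].
assert (Hxb : (1 + K) * Rabs (x - x0) < Rmin d1 d2).
{ apply Rmult_lt_reg_l with (/ (1 + K)); [now apply Rinv_0_lt_compat|].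
  rewrite <- Rmult_assoc, Rinv_l, Rmult_1_l by lra. rewrite (Rmult_comm (/ _)).
  eapply Rlt_le_trans; [exact Hx|apply Rmin_r]. }
set (dx := x - x0) in *. set (dy := Y x - Y x0) in *.
assert (Ed : ((x, Y x) - (x0, Y x0))%C = (dx, dy)) by reflexivity.
assert (Hmod : Cmod (dx, dy) <= (1 + K) * Rabs dx).
{ eapply Rle_trans; [apply Cmod_le_Rabs_plus|]. lra. }
assert (M1 := Rmin_l d1 d2). assert (M2 := Rmin_r d1 d2).
specialize (H1 (x, Y x)). specialize (H2 (x, Y x)). rewrite Ed in H1, H2.
specialize (H1 ltac:(lra)). specialize (H2 ltac:(lra)).
set (A1 := (P (x, Y x) - P (x0, Y x0) - p * (dx, dy))%C) in *.
set (A2 := (Q (x, Y x) - Q (x0, Y x0) - q * (dx, dy))%C) in *.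
assert (I1 : Im A1 = - (Im p * dx + Re p * dy)).
{ assert (T1 := HY x Hax). assert (T2 := HY x0 Hx0).
  unfold A1, Cminus. rewrite !im_plus, !im_opp, im_mult, T1, T2. simpl. ring. }
assert (I2 : Re A2 = Re (Q (x, Y x)) - Re (Q (x0, Y x0)) - (Re q * dx - Im q * dy)).
{ unfold A2. rewrite !Re_minus, re_mult. reflexivity. }
assert (EA : Re (Q (x, Y x)) - Re (Q (x0, Y x0)) - Re (q * Cconj p)%C / Re p * dx
  = Re A2 + s * Im A1).
{ rewrite I1, I2. unfold s. rewrite re_mult, re_conj, im_conj. field. lra. }
match type of EA with ?l = _ => change (Rabs l <= eps * Rabs dx) end. rewrite EA.
eapply Rle_trans; [apply Rabs_triang|]. rewrite Rabs_mult.
assert (B1 := Rabs_im_le_Cmod A1). assert (B2 := re_le_Cmod A2).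
assert (B3 : e * Cmod (dx, dy) <= e * ((1 + K) * Rabs dx)) by (apply Rmult_le_compat_l; lra).
assert (B4 : Rabs s * Rabs (Im A1) <= Rabs s * (e * ((1 + K) * Rabs dx)))
  by (apply Rmult_le_compat_l; lra).
replace (eps * Rabs dx) with (e * ((1 + K) * Rabs dx) + Rabs s * (e * ((1 + K) * Rabs dx)));
  [lra|].
unfold e. field. lra.
Qed.

Lemma is_derive_zero_of_locally_const (f : R -> R) (x d : R) :
  0 < d -> (forall y, Rabs (y - x) < d -> f y = f x) -> is_derive f x 0.
Proof.
intros Hd H. apply is_derive_eps. intros eps Heps. exists d; split; [exact Hd|].
intros y Hy. rewrite (H y Hy).
replace (f x - f x - 0 * (y - x)) with 0 by ring. rewrite Rabs_R0.
apply Rmult_le_pos; [lra|apply Rabs_pos].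
Qed.

(** A separation would make the indicator of [U] along the curve locally constant, so of derivative
    0 on the ray and hence constant, yet it takes both values. *)
Lemma connected_curve (A : C -> Prop) (a : R) (gam : R -> C) :
  (forall w, A w <-> exists x, a < x /\ gam x = w) ->
  (forall x, a < x -> forall U : C -> Prop, open U -> U (gam x) ->
     exists d, 0 < d /\ forall y, Rabs (y - x) < d -> U (gam y)) ->
  connected A.
Proof.
intros HA Hc [U [V [HU [HV [Hcov [[w1 [Aw1 Uw1]] [[w2 [Aw2 Vw2]] Hdis]]]]]]].
apply HA in Aw1. destruct Aw1 as [x1 [Hx1 E1]].
apply HA in Aw2. destruct Aw2 as [x2 [Hx2 E2]]. subst w1 w2.
assert (HAg : forall x, a < x -> A (gam x)) by (intros x Hx; apply HA; now exists x).
set (chi := fun x => if excluded_middle_informative (U (gam x)) then 1 else 0).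
assert (Hchi : forall x, a < x -> is_derive chi x 0).
{ intros x Hx.
  assert (Hloc : exists d, 0 < d /\ forall y, Rabs (y - x) < d -> chi y = chi x).
  { unfold chi. destruct (Hcov _ (HAg x Hx)) as [HUx|HVx].
    - destruct (Hc x Hx U HU HUx) as [d [Hd Hy]]. exists d; split; [exact Hd|].
      intros y Hyd. specialize (Hy y Hyd).
      destruct (excluded_middle_informative (U (gam y))); [|contradiction].
      destruct (excluded_middle_informative (U (gam x))); [reflexivity|contradiction].
    - destruct (Hc x Hx V HV HVx) as [d [Hd Hy]].
      (* Disjointness of [U] and [V] is known only at points of [A], so y must also stay to the
         right of [a]. *)
      exists (Rmin d (x - a)); split; [apply Rmin_pos; lra|].
      intros y Hyd.
      assert (Y1 : Rabs (y - x) < d) by (eapply Rlt_le_trans; [exact Hyd|apply Rmin_l]).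
      assert (Y2 : Rabs (y - x) < x - a) by (eapply Rlt_le_trans; [exact Hyd|apply Rmin_r]).
      apply Rabs_def2 in Y2. assert (Hay : a < y) by lra.
      specialize (Hy y Y1).
      destruct (excluded_middle_informative (U (gam y))) as [u|u].
      { exfalso. apply (Hdis _ (HAg y Hay)). now split. }
      destruct (excluded_middle_informative (U (gam x))) as [u'|u']; [|reflexivity].
      exfalso. apply (Hdis _ (HAg x Hx)). now split. }
  destruct Hloc as [d [Hd Hloc]]. now apply is_derive_zero_of_locally_const with d. }
assert (C1 : chi x1 = 1).
{ unfold chi. destruct (excluded_middle_informative (U (gam x1))); [reflexivity|contradiction]. }
assert (C2 : chi x2 = 0).
{ unfold chi. destruct (excluded_middle_informative (U (gam x2))) as [u|u]; [|reflexivity].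
  exfalso. apply (Hdis _ (HAg x2 Hx2)). now split. }
destruct (Rtotal_order x1 x2) as [H|[H|H]].
- assert (E : chi x1 = chi x2); [|lra].
  apply (@eq_is_derive R_NormedModule); [|exact H]. intros t Ht. apply Hchi. lra.
- subst x2. lra.
- assert (E : chi x2 = chi x1); [|lra].
  apply (@eq_is_derive R_NormedModule); [|exact H]. intros t Ht. apply Hchi. lra.
Qed.

(** Meant for P = H - G and Q = H + G as functions of u: Re Q and Im P are then the two coordinates
    of H + conj G, and the last hypothesis is the positivity of its Jacobian. *)
Lemma halfplane_shear (P P' Q Q' : C -> C) (a : R) :
  (forall u, a < Re u -> Cdiff P u (P' u)) ->
  (forall u, a < Re u -> Cdiff Q u (Q' u)) ->
  (forall u, a < Re u -> Re u - a <= Re (P' u)) ->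
  (forall u, a < Re u -> 0 < Re (Q' u * Cconj (P' u))%C) ->
  (forall u w, a < Re u -> a < Re w ->
     Re (Q u) = Re (Q w) -> Im (P u) = Im (P w) -> u = w) /\
  (forall c, connected (fun w => (exists u, a < Re u /\ (Re (Q u), Im (P u)) = w) /\ Im w = c)).
Proof.
intros HP HQ Hm HJ.
assert (Hinj : forall x y1 y2, a < x -> Im (P (x, y1)) = Im (P (x, y2)) -> y1 = y2).
{ intros x y1 y2 Hx E.
  assert (G := growth_of_derive_ge_abs (fun y => Im (P (x, y))) (fun y => Re (P' (x, y))) (x - a) y1 y2
    ltac:(lra)). cbv beta in G. rewrite E, Rminus_diag, Rabs_R0 in G.
  destruct (Req_dec y1 y2) as [|Hne]; [assumption|exfalso].
  assert (0 < Rabs (y2 - y1)) by (apply Rabs_pos_lt; lra).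
  assert (0 < (x - a) * Rabs (y2 - y1)) by (apply Rmult_lt_0_compat; lra).
  apply Rlt_not_le in H0. apply H0. apply G.
  - intros y. apply (Cdiff_partials P x y (P' (x, y))). now apply HP.
  - intros y. apply (Hm (x, y) Hx). }
assert (Hlev : forall c, exists Y, level_curve P a c Y).
{ intros c.
  (* The guard inside the existential makes the choice of y total; outside the half plane it is the
     dummy 0. *)
  assert (Hex : forall x, exists y, a < x -> Im (P (x, y)) = c).
  { intros x. destruct (Rlt_dec a x) as [Hx|Hx]; [|exists 0; intros; contradiction].
    destruct (surjective_of_derive_ge (fun y => Im (P (x, y))) (fun y => Re (P' (x, y))) (x - a) c)
      as [y Hy]; [lra| | |now exists y].
    - intros y. apply (Cdiff_partials P x y (P' (x, y))). now apply HP.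
    - intros y. apply (Hm (x, y) Hx). }
  exists (fun x => proj1_sig (constructive_indefinite_description _ (Hex x))).
  intros x Hx. destruct (constructive_indefinite_description _ (Hex x)) as [y Hy]. now apply Hy. }
split.
- intros [x1 y1] [x2 y2] H1 H2 EQ EP. simpl in H1, H2.
  destruct (Hlev (Im (P (x1, y1)))) as [Y HY].
  assert (E1 : Y x1 = y1) by (apply (Hinj x1); [exact H1|apply HY; exact H1]).
  assert (E2 : Y x2 = y2) by (apply (Hinj x2); [exact H2|rewrite (HY x2 H2); exact EP]).
  assert (Hincr : forall s t, a < s -> s < t -> Re (Q (s, Y s)) < Re (Q (t, Y t))).
  { intros s t Hs Hst.
    apply (incr_function (fun x => Re (Q (x, Y x))) a p_infty
      (fun x => Re (Q' (x, Y x) * Cconj (P' (x, Y x)))%C / Re (P' (x, Y x)))); simpl; auto.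
    - intros x Hx _. now apply (is_derive_along_level P P' Q Q' a (Im (P (x1, y1))) Y x).
    - intros x Hx _. apply Rdiv_lt_0_compat; [now apply HJ|].
      specialize (Hm (x, Y x) Hx). simpl in Hm. lra. }
  subst y1 y2.
  destruct (Rtotal_order x1 x2) as [H|[H|H]].
  + specialize (Hincr x1 x2 H1 H). lra.
  + now subst x2.
  + specialize (Hincr x2 x1 H2 H). lra.
- intros c. destruct (Hlev c) as [Y HY].
  apply connected_curve with a (fun x => (Re (Q (x, Y x)), c)).
  + intros w; split.
    * intros [[[x y] [Hu E]] Ec]. simpl in Hu. exists x; split; [exact Hu|].
      rewrite <- E in Ec |- *. simpl in Ec.
      replace (Y x) with y; [now rewrite Ec|].
      apply (Hinj x); [exact Hu|]. now rewrite (HY x Hu).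
    * intros [x [Hx E]]. subst w. split; [|reflexivity].
      exists (x, Y x); split; [exact Hx|]. now rewrite (HY x Hx).
  + intros x Hx U HU HUx.
    assert (D := is_derive_along_level P P' Q Q' a c Y x HP HQ Hm HY Hx).
    assert (Hcont : continuous (fun x => Re (Q (x, Y x))) x)
      by (apply (@ex_derive_continuous R_AbsRing R_NormedModule); eexists; exact D).
    destruct (HU _ HUx) as [e He].
    unfold continuous, filterlim, filter_le, filtermap in Hcont.
    destruct (Hcont (@ball R_UniformSpace (Re (Q (x, Y x))) e)) as [d Hd]; [now exists e|].
    exists d; split; [apply cond_pos|]. intros y Hy. apply He. split; simpl.
    * apply Hd, Hy.
    * apply ball_center.
Qed.

(** * Power series on the disk *)

Definition Cseries (a : nat -> C) (l : C) : Prop :=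
  is_series (fun n => Re (a n)) (Re l) /\ is_series (fun n => Im (a n)) (Im l).

Lemma Cseries_unique (a : nat -> C) (l : C) : Cseries a l -> C_Series a = l.
Proof.
intros [H1 H2]. unfold C_Series.
rewrite (is_series_unique _ _ H1), (is_series_unique _ _ H2). now destruct l.
Qed.

Lemma Cseries_ext (a b : nat -> C) (l : C) :
  (forall n, a n = b n) -> Cseries a l -> Cseries b l.
Proof.
intros H [H1 H2]; split.
- eapply is_series_ext; [|exact H1]. intros n; cbv beta; now rewrite H.
- eapply is_series_ext; [|exact H2]. intros n; cbv beta; now rewrite H.
Qed.

Lemma Cseries_plus (a b : nat -> C) (l m : C) :
  Cseries a l -> Cseries b m -> Cseries (fun n => a n + b n)%C (l + m)%C.
Proof.
intros [H1 H2] [H3 H4]; split.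
- exact (is_series_plus _ _ _ _ H1 H3).
- exact (is_series_plus _ _ _ _ H2 H4).
Qed.

Lemma Cseries_scal (c : C) (a : nat -> C) (l : C) :
  Cseries a l -> Cseries (fun n => c * a n)%C (c * l)%C.
Proof.
intros [H1 H2]; split.
- rewrite re_mult. apply is_series_ext with (fun n => minus (Re c * Re (a n)) (Im c * Im (a n))).
  + intros n. now rewrite re_mult.
  + apply (is_series_minus (V := R_NormedModule)).
    * exact (is_series_scal (Re c) _ _ H1).
    * exact (is_series_scal (Im c) _ _ H2).
- rewrite im_mult. apply is_series_ext with (fun n => plus (Re c * Im (a n)) (Im c * Re (a n))).
  + intros n. now rewrite im_mult.
  + apply (is_series_plus (V := R_NormedModule)).
    * exact (is_series_scal (Re c) _ _ H2).
    * exact (is_series_scal (Im c) _ _ H1).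
Qed.

Lemma is_series_eq (a : nat -> R) (l m : R) : is_series a l -> l = m -> is_series a m.
Proof. now intros H <-. Qed.

Lemma Cseries_incr_1 (a : nat -> C) (l : C) :
  Cseries a l -> Cseries (fun n => a (S n)) (l - a 0%nat)%C.
Proof.
intros [H1 H2]; split.
- apply (is_series_incr_1 (fun n => Re (a n))). apply (is_series_eq _ _ _ H1).
  rewrite Re_minus. unfold plus; simpl; ring.
- apply (is_series_incr_1 (fun n => Im (a n))). apply (is_series_eq _ _ _ H2).
  unfold Cminus. rewrite im_plus, im_opp. unfold plus; simpl; ring.
Qed.

Lemma Cseries_decr_1 (a : nat -> C) (l : C) :
  Cseries (fun n => a (S n)) l -> Cseries a (a 0%nat + l)%C.
Proof.
intros [H1 H2]; split; apply is_series_decr_1.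
- apply (is_series_eq _ _ _ H1). rewrite re_plus. unfold plus, opp; simpl; ring.
- apply (is_series_eq _ _ _ H2). rewrite im_plus. unfold plus, opp; simpl; ring.
Qed.

Lemma is_series_0 : is_series (fun _ : nat => 0) 0.
Proof.
apply (is_series_eq _ (0 * / (1 - 0))); [|ring].
apply is_series_ext with (fun n : nat => 0 * 0 ^ n); [intros n; apply Rmult_0_l|].
apply (is_series_scal_l 0 (fun n => 0 ^ n)), is_series_geom. rewrite Rabs_R0. lra.
Qed.

Lemma Cseries_0 : Cseries (fun _ => 0%C) 0%C.
Proof. split; exact is_series_0. Qed.

Lemma Cseries_of_Cmod (a : nat -> C) :
  ex_series (fun n => Cmod (a n)) -> Cseries a (C_Series a).
Proof.
intros H; split; apply Series_correct.
- apply (@ex_series_le R_AbsRing R_CompleteNormedModule _ (fun n => Cmod (a n))); [|exact H].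
  intros n. apply re_le_Cmod.
- apply (@ex_series_le R_AbsRing R_CompleteNormedModule _ (fun n => Cmod (a n))); [|exact H].
  intros n. apply Rabs_im_le_Cmod.
Qed.

Lemma is_series_Rabs_le (a b : nat -> R) (l B : R) :
  is_series a l -> is_series b B -> (forall n, Rabs (a n) <= b n) -> Rabs l <= B.
Proof.
intros Ha Hb H.
assert (Hex : ex_series (fun n => Rabs (a n))).
{ apply (@ex_series_le R_AbsRing R_CompleteNormedModule _ b); [|now exists B].
  intros n. unfold norm; simpl. unfold abs; simpl. now rewrite Rabs_Rabsolu. }
rewrite <- (is_series_unique _ _ Ha), <- (is_series_unique _ _ Hb).
eapply Rle_trans; [now apply Series_Rabs|].
apply Series_le; [|now exists B]. intros n; split; [apply Rabs_pos|apply H].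
Qed.

(** The factor 2 comes from bounding real and imaginary parts separately; it is harmless in the
    remainder estimate it serves. *)
Lemma Cseries_Cmod_le (a : nat -> C) (b : nat -> R) (l : C) (B : R) :
  Cseries a l -> is_series b B -> (forall n, Cmod (a n) <= b n) -> Cmod l <= 2 * B.
Proof.
intros [H1 H2] Hb H.
assert (R1 : Rabs (Re l) <= B).
{ apply (is_series_Rabs_le _ b _ _ H1 Hb). intros n. eapply Rle_trans; [apply re_le_Cmod|apply H]. }
assert (R2 : Rabs (Im l) <= B).
{ apply (is_series_Rabs_le _ b _ _ H2 Hb). intros n. eapply Rle_trans; [apply Rabs_im_le_Cmod|apply H]. }
destruct l as [x y]. eapply Rle_trans; [apply Cmod_le_Rabs_plus|]. simpl in R1, R2. lra.
Qed.

(** * Operations on power series converging in the disk *)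

(** Radius of convergence at least 1, stated without a limsup. Absolute convergence at radius r
    follows by comparison with a geometric series after enlarging r to (1 + r)/2. *)
Definition coef_bounded (a : nat -> C) : Prop :=
  forall r : R, 0 < r < 1 -> exists M : R, forall n, Cmod (a n) * r ^ n <= M.

Definition disk_pseries (a : nat -> C) (f : C -> C) : Prop :=
  coef_bounded a /\ forall z, disk z -> Cseries (fun n => a n * z ^ n)%C (f z).

Definition coef_derive (a : nat -> C) (n : nat) : C := (INR (S n) * a (S n))%C.

Lemma coef_bounded_summable (a : nat -> C) (r : R) :
  coef_bounded a -> 0 <= r < 1 -> ex_series (fun n => Cmod (a n) * r ^ n).
Proof.
intros Ha Hr. set (s := (1 + r) / 2).
assert (Hs : 0 < s < 1) by (unfold s; lra).
destruct (Ha s Hs) as [M HM].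
assert (Hq : 0 <= r / s < 1).
{ split; [apply Rle_mult_inv_pos; lra|]. apply Rmult_lt_reg_r with s; [lra|].
  unfold Rdiv. rewrite Rmult_assoc, Rinv_l by lra. unfold s; lra. }
apply (@ex_series_le R_AbsRing R_CompleteNormedModule _ (fun n => M * (r / s) ^ n)).
- intros n. unfold norm; simpl. unfold abs; simpl.
  rewrite Rabs_pos_eq by (apply Rmult_le_pos; [apply Cmod_ge_0|apply pow_le; lra]).
  replace (Cmod (a n) * r ^ n) with (Cmod (a n) * s ^ n * (r / s) ^ n).
  + apply Rmult_le_compat_r; [apply pow_le; lra|apply HM].
  + unfold Rdiv. rewrite Rpow_mult_distr, pow_inv.
    field. apply pow_nonzero; lra.
- apply (ex_series_scal (V := R_NormedModule) M). apply ex_series_geom.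
  rewrite Rabs_pos_eq; lra.
Qed.

Lemma coef_bounded_Cseries (a : nat -> C) (z : C) :
  coef_bounded a -> disk z ->
  Cseries (fun n => a n * z ^ n)%C (C_Series (fun n => a n * z ^ n)%C).
Proof.
intros Ha Hz. apply Cseries_of_Cmod.
eapply ex_series_ext; [|apply (coef_bounded_summable a (Cmod z) Ha)].
- intros n. now rewrite Cmod_mult, Cmod_pow.
- split; [apply Cmod_ge_0|exact Hz].
Qed.

Lemma disk_pseries_exists (a : nat -> C) :
  coef_bounded a -> disk_pseries a (fun z => C_Series (fun n => a n * z ^ n)%C).
Proof. intros Ha; split; [exact Ha|]. intros z Hz. now apply coef_bounded_Cseries. Qed.

Lemma disk_pseries_ext (a b : nat -> C) (f g : C -> C) :
  (forall n, a n = b n) -> (forall z, disk z -> f z = g z) ->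
  disk_pseries a f -> disk_pseries b g.
Proof.
intros Hab Hfg [H1 H2]; split.
- intros r Hr. destruct (H1 r Hr) as [M HM]. exists M. intros n. now rewrite <- Hab.
- intros z Hz. rewrite <- (Hfg z Hz). eapply Cseries_ext; [|apply H2, Hz].
  intros n; cbv beta. now rewrite Hab.
Qed.

Lemma disk_pseries_plus (a b : nat -> C) (f g : C -> C) :
  disk_pseries a f -> disk_pseries b g ->
  disk_pseries (fun n => a n + b n)%C (fun z => f z + g z)%C.
Proof.
intros [Ha Hf] [Hb Hg]; split.
- intros r Hr. destruct (Ha r Hr) as [M HM]. destruct (Hb r Hr) as [N HN].
  exists (M + N). intros n. specialize (HM n). specialize (HN n).
  assert (T := Cmod_triangle (a n) (b n)).
  assert (0 <= r ^ n) by (apply pow_le; lra).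
  assert (Cmod (a n + b n)%C * r ^ n <= (Cmod (a n) + Cmod (b n)) * r ^ n)
    by (apply Rmult_le_compat_r; lra).
  lra.
- intros z Hz. eapply Cseries_ext; [|apply (Cseries_plus _ _ _ _ (Hf z Hz) (Hg z Hz))].
  intros n; cbv beta; ring.
Qed.

Lemma disk_pseries_scal (c : C) (a : nat -> C) (f : C -> C) :
  disk_pseries a f -> disk_pseries (fun n => c * a n)%C (fun z => c * f z)%C.
Proof.
intros [Ha Hf]; split.
- intros r Hr. destruct (Ha r Hr) as [M HM].
  exists (Cmod c * M). intros n. rewrite Cmod_mult, Rmult_assoc.
  apply Rmult_le_compat_l; [apply Cmod_ge_0|apply HM].
- intros z Hz. eapply Cseries_ext; [|apply (Cseries_scal c _ _ (Hf z Hz))].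
  intros n; cbv beta; ring.
Qed.

Definition coef_shift (a : nat -> C) (n : nat) : C :=
  match n with O => 0%C | S k => a k end.

Lemma disk_pseries_mulz (a : nat -> C) (f : C -> C) :
  disk_pseries a f -> disk_pseries (coef_shift a) (fun z => z * f z)%C.
Proof.
intros [Ha Hf]; split.
- intros r Hr. destruct (Ha r Hr) as [M HM].
  assert (HM0 : 0 <= M).
  { eapply Rle_trans; [|apply (HM 0%nat)]. simpl. rewrite Rmult_1_r. apply Cmod_ge_0. }
  exists M. intros [|n]; simpl.
  + rewrite Cmod_0. lra.
  + specialize (HM n).
    assert (0 <= Cmod (a n) * r ^ n) by (apply Rmult_le_pos; [apply Cmod_ge_0|apply pow_le; lra]).
    assert (Cmod (a n) * r ^ n * r <= Cmod (a n) * r ^ n * 1) by (apply Rmult_le_compat_l; lra).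
    lra.
- intros z Hz.
  replace (z * f z)%C with (coef_shift a 0 * z ^ 0 + z * f z)%C by (simpl; ring).
  apply (Cseries_decr_1 (fun n => coef_shift a n * z ^ n)%C).
  eapply Cseries_ext; [|apply (Cseries_scal z _ _ (Hf z Hz))].
  intros n. simpl. ring.
Qed.

(** The recursion obtained by comparing coefficients in b(z) (1 - c z) = a(z); it stands in for the
    Cauchy product with a geometric series. *)
Fixpoint coef_geom (c : C) (a : nat -> C) (n : nat) : C :=
  match n with
  | O => a O
  | S k => (c * coef_geom c a k + a (S k))%C
  end.

(** The recursion on coefficients turns into the equation s = f z + c z s for the sum, which can be
    solved since c z is not 1. *)
Lemma disk_pseries_div (c : C) (a : nat -> C) (f : C -> C) :
  Cmod c <= 1 -> disk_pseries a f ->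
  disk_pseries (coef_geom c a) (fun z => f z / (1 - c * z))%C.
Proof.
intros Hc [Ha Hf].
assert (Hb : coef_bounded (coef_geom c a)).
(* M / (1 - r) is the fixed point of B = r B + M, the recursion that the bounds obey. *)
{ intros r Hr. destruct (Ha r Hr) as [M HM]. exists (M / (1 - r)).
  assert (HM0 : 0 <= M).
  { eapply Rle_trans; [|apply (HM 0%nat)]. simpl. rewrite Rmult_1_r. apply Cmod_ge_0. }
  assert (E : M / (1 - r) = r * (M / (1 - r)) + M) by (field; lra).
  assert (HB : 0 <= M / (1 - r)) by (apply Rle_mult_inv_pos; lra).
  assert (0 <= r * (M / (1 - r))) by (apply Rmult_le_pos; lra).
  induction n as [|n IH].
  - eapply Rle_trans; [apply (HM 0%nat)|]. lra.
  - rewrite E. change (coef_geom c a (S n)) with (c * coef_geom c a n + a (S n))%C.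
    eapply Rle_trans.
    { apply Rmult_le_compat_r; [apply pow_le; lra|apply Cmod_triangle]. }
    rewrite Rmult_plus_distr_r. apply Rplus_le_compat; [|apply HM].
    rewrite Cmod_mult. simpl.
    replace (Cmod c * Cmod (coef_geom c a n) * (r * r ^ n))
      with (r * (Cmod c * (Cmod (coef_geom c a n) * r ^ n))) by ring.
    apply Rmult_le_compat_l; [lra|].
    eapply Rle_trans; [|exact IH]. rewrite <- (Rmult_1_l (Cmod (coef_geom c a n) * r ^ n)) at 2.
    apply Rmult_le_compat_r; [|exact Hc].
    apply Rmult_le_pos; [apply Cmod_ge_0|apply pow_le; lra]. }
split; [exact Hb|]. intros z Hz.
assert (HS := coef_bounded_Cseries _ z Hb Hz).
set (s := C_Series (fun n => coef_geom c a n * z ^ n)%C) in *.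
assert (E1 : Cseries (fun n => coef_geom c a n * z ^ n)%C (f z + c * z * s)%C).
{ replace (f z + c * z * s)%C with (coef_geom c a 0 * z ^ 0 + (c * z * s + (f z - a 0%nat * z ^ 0)))%C
    by (simpl; ring).
  apply (Cseries_decr_1 (fun n => coef_geom c a n * z ^ n)%C).
  eapply Cseries_ext; [|apply (Cseries_plus _ _ _ _ (Cseries_scal (c * z)%C _ _ HS)
    (Cseries_incr_1 _ _ (Hf z Hz)))].
  intros n. simpl. ring. }
assert (E2 : s = (f z + c * z * s)%C).
{ transitivity (C_Series (fun n => coef_geom c a n * z ^ n)%C); [reflexivity|].
  now apply Cseries_unique. }
assert (Hne : (1 - c * z)%C <> 0%C).
{ intros H0. assert (H1 : (c * z)%C = 1%C) by (rewrite <- (Cplus_0_r (c * z)), <- H0; ring).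
  assert (H2 : Cmod c * Cmod z = 1) by (rewrite <- Cmod_mult, H1; apply Cmod_1).
  unfold disk in Hz. assert (T := Cmod_ge_0 z).
  assert (Cmod c * Cmod z <= 1 * Cmod z) by (apply Rmult_le_compat_r; lra). lra. }
replace (f z / (1 - c * z))%C with s; [exact HS|].
replace (f z) with (s - c * z * s)%C by (rewrite E2 at 1; ring). field. exact Hne.
Qed.

(** Each of the n + 1 terms of 1 + x + ... + x^n is at least x^n. *)
Lemma INR_pow_bounded (x : R) (n : nat) : 0 <= x < 1 -> INR (S n) * x ^ n <= / (1 - x).
Proof.
intros Hx.
assert (H : INR (S n) * x ^ n * (1 - x) <= 1 - x ^ S n).
{ induction n as [|n IH]; [simpl; lra|].
  assert (P1 : 0 <= x ^ S n) by (apply pow_le; lra).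
  assert (P2 : x ^ S n <= 1) by (rewrite <- (pow1 (S n)); apply pow_incr; lra).
  rewrite S_INR. change (x ^ S (S n)) with (x * x ^ S n).
  change (x ^ S n) with (x * x ^ n) in *.
  assert (x * (INR (S n) * x ^ n * (1 - x)) <= x * (1 - x * x ^ n))
    by (apply Rmult_le_compat_l; lra).
  nra. }
assert (0 <= x ^ S n) by (apply pow_le; lra).
apply Rmult_le_reg_r with (1 - x); [lra|]. rewrite Rinv_l by lra. lra.
Qed.

(** The factor n + 1 is absorbed by (r/s)^n, where s is a radius between r and 1. *)
Lemma coef_bounded_derive (a : nat -> C) : coef_bounded a -> coef_bounded (coef_derive a).
Proof.
intros Ha r Hr. set (s := (1 + r) / 2).
assert (Hs : 0 < s < 1) by (unfold s; lra).
destruct (Ha s Hs) as [M HM].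
assert (Hq : 0 <= r / s < 1).
{ split; [apply Rle_mult_inv_pos; lra|]. apply Rmult_lt_reg_r with s; [lra|].
  unfold Rdiv. rewrite Rmult_assoc, Rinv_l by lra. unfold s; lra. }
exists (M / s * / (1 - r / s)). intros n. unfold coef_derive.
rewrite Cmod_mult, Cmod_R, Rabs_pos_eq by apply pos_INR.
replace (INR (S n) * Cmod (a (S n)) * r ^ n)
  with (Cmod (a (S n)) * s ^ S n / s * (INR (S n) * (r / s) ^ n)).
- apply Rmult_le_compat.
  + apply Rle_mult_inv_pos; [|lra]. apply Rmult_le_pos; [apply Cmod_ge_0|apply pow_le; lra].
  + apply Rmult_le_pos; [apply pos_INR|apply pow_le; lra].
  + apply Rmult_le_compat_r; [apply Rlt_le, Rinv_0_lt_compat; lra|apply HM].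
  + now apply INR_pow_bounded.
- unfold Rdiv. rewrite Rpow_mult_distr, pow_inv. simpl pow.
  field. split; [apply pow_nonzero; lra|lra].
Qed.

(** The remainders obey R_(n+1) = w R_n + (n+1) z^n (w - z)^2, and (n+1) n + (n+1) <= (n+2) (n+1).
    At n = 0 the factor [INR n] vanishes, so the value of [pred 0] does not matter. *)
Lemma pow_taylor_bound (z w : C) (r : R) (n : nat) :
  Cmod z <= r -> Cmod w <= r ->
  Cmod (w ^ S n - z ^ S n - INR (S n) * z ^ n * (w - z))%C <=
  INR (S n) * INR n * r ^ pred n * (Cmod (w - z) * Cmod (w - z)).
Proof.
intros Hz Hw. set (d := Cmod (w - z)).
assert (Hd : 0 <= d * d) by (apply Rle_0_sqr).
assert (Hr : 0 <= r) by (eapply Rle_trans; [apply Cmod_ge_0|exact Hz]).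
induction n as [|n IH].
- replace (w ^ 1 - z ^ 1 - INR 1 * z ^ 0 * (w - z))%C with (RtoC 0) by (simpl; ring).
  rewrite Cmod_0. simpl. lra.
- replace (w ^ S (S n) - z ^ S (S n) - INR (S (S n)) * z ^ S n * (w - z))%C
    with (w * (w ^ S n - z ^ S n - INR (S n) * z ^ n * (w - z))
          + INR (S n) * z ^ n * ((w - z) * (w - z)))%C.
  2:{ rewrite (S_INR (S n)), RtoC_plus, !Cpow_S. ring. }
  eapply Rle_trans; [apply Cmod_triangle|].
  rewrite !Cmod_mult, Cmod_R, Cmod_pow, (Rabs_pos_eq (INR (S n))) by apply pos_INR.
  fold d.
  assert (Hrn : 0 <= r ^ n) by (now apply pow_le).
  assert (B1 : Cmod w * Cmod (w ^ S n - z ^ S n - INR (S n) * z ^ n * (w - z))%C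
    <= r * (INR (S n) * INR n * r ^ pred n * (d * d))).
  { apply Rmult_le_compat; [apply Cmod_ge_0|apply Cmod_ge_0|exact Hw|exact IH]. }
  assert (B2 : r * (INR (S n) * INR n * r ^ pred n * (d * d)) = INR (S n) * INR n * r ^ n * (d * d)).
  { destruct n; simpl; ring. }
  assert (B3 : INR (S n) * Cmod z ^ n * (d * d) <= INR (S n) * r ^ n * (d * d)).
  { apply Rmult_le_compat_r; [exact Hd|]. apply Rmult_le_compat_l; [apply pos_INR|].
    apply pow_incr. split; [apply Cmod_ge_0|exact Hz]. }
  simpl pred. rewrite (S_INR (S n)).
  assert (0 <= INR (S n) * r ^ n * (d * d)).
  { apply Rmult_le_pos; [|exact Hd]. apply Rmult_le_pos; [apply pos_INR|exact Hrn]. }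
  rewrite (S_INR n) in *. nra.
Qed.

Lemma Cdiff_of_quadratic (F : C -> C) (z l : C) (d K : R) :
  0 < d -> 0 <= K ->
  (forall w, Cmod (w - z) < d ->
     Cmod (F w - F z - l * (w - z))%C <= K * (Cmod (w - z) * Cmod (w - z))) ->
  Cdiff F z l.
Proof.
intros Hd HK H eps Heps.
exists (Rmin d (eps / (K + 1))); split.
{ apply Rmin_pos; [exact Hd|apply Rdiv_lt_0_compat; lra]. }
intros w Hw.
assert (H1 : Cmod (w - z) < d) by (eapply Rlt_le_trans; [exact Hw|apply Rmin_l]).
assert (H2 : Cmod (w - z) < eps / (K + 1)) by (eapply Rlt_le_trans; [exact Hw|apply Rmin_r]).
eapply Rle_trans; [now apply H|]. rewrite <- Rmult_assoc.
apply Rmult_le_compat_r; [apply Cmod_ge_0|].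
assert (H3 : (K + 1) * Cmod (w - z) <= (K + 1) * (eps / (K + 1))) by (apply Rmult_le_compat_l; lra).
replace ((K + 1) * (eps / (K + 1))) with eps in H3 by (field; lra).
assert (T := Cmod_ge_0 (w - z)). lra.
Qed.

(** The second order remainders of the powers sum to at most a constant times |w - z|^2, because the
    twice derived series still converges absolutely at a radius r strictly between |z| and 1; the w
    considered satisfy |w| <= r. *)
Lemma disk_pseries_Cdiff (a : nat -> C) (f f' : C -> C) (z : C) :
  disk_pseries a f -> disk_pseries (coef_derive a) f' -> disk z -> Cdiff f z (f' z).
Proof.
intros [Ha Hf] [Ha' Hf'] Hz. assert (Hz' := Hz). unfold disk in Hz'.
assert (Hz0 := Cmod_ge_0 z).
set (r := (1 + Cmod z) / 2).
assert (Hr : 0 <= r < 1) by (unfold r; lra).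
set (b := fun n => Cmod (a (S n)) * (INR (S n) * INR n * r ^ pred n)).
assert (Hb : ex_series b).
{ apply ex_series_incr_1.
  eapply ex_series_ext;
    [|apply (coef_bounded_summable (coef_derive (coef_derive a)) r); [|exact Hr]].
  - intros n. unfold b, coef_derive. rewrite !Cmod_mult, !Cmod_R, !Rabs_pos_eq by apply pos_INR.
    simpl pred. match goal with |- ?x = ?y => change (@eq R x y) end; ring.
  - now apply coef_bounded_derive. }
destruct Hb as [B HB].
assert (HB0 : 0 <= B).
{ rewrite <- Rabs_R0. apply (is_series_Rabs_le (fun _ => 0) b); [exact is_series_0|exact HB|].
  intros n. rewrite Rabs_R0. unfold b. apply Rmult_le_pos; [apply Cmod_ge_0|].
    repeat apply Rmult_le_pos; try apply pos_INR. apply pow_le; lra. }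
apply Cdiff_of_quadratic with ((1 - Cmod z) / 2) (2 * B); [lra|lra|].
intros w Hw.
assert (Hwr : Cmod w <= r).
{ replace w with ((w - z) + z)%C by ring. eapply Rle_trans; [apply Cmod_triangle|]. unfold r; lra. }
assert (Hdw : disk w) by (unfold disk; lra).
set (d := Cmod (w - z)) in *.
assert (HS : Cseries (fun n => a (S n) * (w ^ S n - z ^ S n - INR (S n) * z ^ n * (w - z)))%C
  (f w - f z - f' z * (w - z))%C).
(* Without their constant terms the series of f are aligned with that of f', whose n-th term stems
   from exponent n + 1. *)
{ replace (f w - f z - f' z * (w - z))%C with
    ((f w - a 0%nat * w ^ 0) + ((-1) * (f z - a 0%nat * z ^ 0) + (- (w - z)) * f' z))%C
    by (simpl; ring).
  eapply Cseries_ext; [|exact (Cseries_plus _ _ _ _ (Cseries_incr_1 _ _ (Hf w Hdw))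
    (Cseries_plus _ _ _ _ (Cseries_scal (-1)%C _ _ (Cseries_incr_1 _ _ (Hf z Hz)))
       (Cseries_scal (- (w - z))%C _ _ (Hf' z Hz))))].
  intros n. unfold coef_derive. simpl. ring. }
rewrite Rmult_assoc.
apply (Cseries_Cmod_le _ (fun n => b n * (d * d)) _ (B * (d * d)) HS).
- apply (is_series_scal_r (d * d) b B HB).
- intros n. rewrite Cmod_mult. unfold b. rewrite Rmult_assoc.
  apply Rmult_le_compat_l; [apply Cmod_ge_0|].
  apply pow_taylor_bound; [unfold r; lra|exact Hwr].
Qed.

Lemma disk_pseries_derive (a : nat -> C) (f : C -> C) :
  disk_pseries a f ->
  disk_pseries (coef_derive a) (C_derive f) /\
  forall z, disk z -> Cdiff f z (C_derive f z).
Proof.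
intros H.
assert (H' := disk_pseries_exists _ (coef_bounded_derive a (proj1 H))).
assert (D := fun z Hz => disk_pseries_Cdiff a f _ z H H' Hz). cbv beta in D.
split.
- eapply disk_pseries_ext; [reflexivity| |exact H'].
  intros z Hz. symmetry. now apply Cdiff_C_derive, D.
- intros z Hz. rewrite (Cdiff_C_derive _ _ _ (D z Hz)). now apply D.
Qed.

Lemma disk_0 : disk 0%C.
Proof. unfold disk. rewrite Cmod_0. lra. Qed.

Lemma disk_pseries_at_0 (a : nat -> C) (f : C -> C) : disk_pseries a f -> f 0%C = a 0%nat.
Proof.
intros [_ H]. specialize (H 0%C disk_0). apply Cseries_unique in H. rewrite <- H.
apply Cseries_unique.
replace (a 0%nat) with (a 0%nat * 0 ^ 0 + 0)%C by (simpl; ring).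
apply (Cseries_decr_1 (fun n => a n * 0 ^ n)%C).
apply (Cseries_ext (fun _ => 0%C)); [intros n; simpl; ring|exact Cseries_0].
Qed.

Lemma disk_pseries_derive_n (a : nat -> C) (f : C -> C) (n : nat) :
  disk_pseries a f ->
  disk_pseries (fun k => a (n + k)%nat * (INR (fact (n + k)) / INR (fact k)))%C (C_derive_n f n).
Proof.
intros H. induction n as [|n IH].
- eapply disk_pseries_ext; [|reflexivity|exact H].
  intros k. simpl. assert (HF := INR_fact_neq_0 k).
  field. now intros E; apply RtoC_inj in E.
- simpl C_derive_n. apply disk_pseries_derive in IH. destruct IH as [IH _].
  eapply disk_pseries_ext; [|reflexivity|exact IH].
  intros k. unfold coef_derive. rewrite Nat.add_succ_r. simpl Nat.add.
  rewrite (fact_simpl k), mult_INR, RtoC_mult.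
  assert (HF := INR_fact_neq_0 k). assert (HS : INR (S k) <> 0) by (apply not_0_INR; lia).
  field. split; now intros E; apply RtoC_inj in E.
Qed.

Lemma taylor_coef_disk_pseries (a : nat -> C) (f : C -> C) (n : nat) :
  disk_pseries a f -> taylor_coef f n = a n.
Proof.
intros H. unfold taylor_coef.
rewrite (disk_pseries_at_0 _ _ (disk_pseries_derive_n a f n H)).
rewrite Nat.add_0_r. simpl (fact 0). simpl (INR 1).
assert (HF := INR_fact_neq_0 n). field. now intros E; apply RtoC_inj in E.
Qed.

(** [conv] starts at exponent 1, so the constant term of the product has to vanish. *)
Lemma conv_disk_pseries (a b : nat -> C) (f F G : C -> C) (z : C) :
  disk_pseries a f -> disk_pseries b F -> disk_pseries (fun n => a n * b n)%C G ->
  a 0%nat = 0%C -> disk z -> conv f F z = G z.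
Proof.
intros Ha Hb HG Ha0 Hz. unfold conv. apply Cseries_unique.
eapply Cseries_ext; [|replace (G z) with (G z - a 0%nat * b 0%nat * z ^ 0)%C;
  [apply (Cseries_incr_1 (fun n => a n * b n * z ^ n)%C), (proj2 HG z Hz)|rewrite Ha0; ring]].
intros n; cbv beta.
now rewrite (taylor_coef_disk_pseries a f), (taylor_coef_disk_pseries b F).
Qed.

(** * Termwise primitives *)

Definition coef_int (q : nat -> C) (n : nat) : C :=
  match n with O => 0%C | S k => (q k / INR (S k))%C end.

Lemma coef_derive_int (q : nat -> C) (n : nat) : coef_derive (coef_int q) n = q n.
Proof.
unfold coef_derive, coef_int. assert (HS : INR (S n) <> 0) by (apply not_0_INR; lia).
field. now intros E; apply RtoC_inj in E.
Qed.

Lemma disk_pseries_primitive (q : nat -> C) (Q : C -> C) :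
  disk_pseries q Q -> exists F, disk_pseries (coef_int q) F /\
    F 0%C = 0%C /\ forall z, disk z -> Cdiff F z (Q z).
Proof.
intros HQ.
assert (Hb : coef_bounded (coef_int q)).
{ intros r Hr. destruct HQ as [Hq _]. destruct (Hq r Hr) as [M HM].
  assert (HM0 : 0 <= M).
  { eapply Rle_trans; [|apply (HM 0%nat)]. simpl. rewrite Rmult_1_r. apply Cmod_ge_0. }
  exists M. intros [|n].
  - simpl. rewrite Cmod_0. lra.
  - unfold coef_int. assert (HS : 1 <= INR (S n)) by (rewrite S_INR; assert (T := pos_INR n); lra).
    rewrite Cmod_div by (intros E; apply RtoC_inj in E; lra).
    rewrite Cmod_R, Rabs_pos_eq by lra. specialize (HM n).
    assert (P : 0 <= Cmod (q n) * r ^ n) by (apply Rmult_le_pos; [apply Cmod_ge_0|apply pow_le; lra]).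
    assert (HI : / INR (S n) <= 1) by (rewrite <- Rinv_1; apply Rinv_le_contravar; lra).
    assert (HI0 : 0 < / INR (S n)) by (apply Rinv_0_lt_compat; lra).
    replace (Cmod (q n) / INR (S n) * r ^ S n) with (Cmod (q n) * r ^ n * (r * / INR (S n)))
      by (simpl pow; unfold Rdiv; ring).
    assert (r * / INR (S n) <= 1 * 1) by (apply Rmult_le_compat; lra).
    assert (Cmod (q n) * r ^ n * (r * / INR (S n)) <= Cmod (q n) * r ^ n * 1)
      by (apply Rmult_le_compat_l; lra).
    lra. }
assert (HF := disk_pseries_exists _ Hb).
eexists; split; [exact HF|]. split.
- now rewrite (disk_pseries_at_0 _ _ HF).
- intros z Hz. apply (disk_pseries_Cdiff _ _ Q z HF); [|exact Hz].
  eapply disk_pseries_ext; [|reflexivity|exact HQ]. intros n. symmetry. apply coef_derive_int.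
Qed.

(** Along the radius to z the real parts of F and of -i F have derivative 0. *)
Lemma Cdiff_zero_const (F : C -> C) (z : C) :
  (forall w, disk w -> Cdiff F w 0%C) -> disk z -> F z = F 0%C.
Proof.
intros HF Hz.
assert (H : forall G : C -> C, (forall w, disk w -> Cdiff G w 0%C) -> Re (G z) = Re (G 0%C)).
{ intros G HG.
  assert (E : Re (G (0 + 0%R * z)%C) = Re (G (0 + 1%R * z)%C)).
  { apply (@eq_is_derive R_NormedModule (fun t : R => Re (G (0 + t * z)%C))); [|lra].
    intros t Ht. replace (@zero R_NormedModule) with (Re (0 * z)%C).
    - apply is_derive_Re_line, HG. unfold disk in *.
      rewrite Cplus_0_l, Cmod_mult, Cmod_R, Rabs_pos_eq by lra.
      assert (T := Cmod_ge_0 z).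
      assert (t * Cmod z <= 1 * Cmod z) by (apply Rmult_le_compat_r; lra). lra.
    - rewrite Cmult_0_l. reflexivity. }
  replace (0 + 0%R * z)%C with (RtoC 0) in E by ring.
  replace (0 + 1%R * z)%C with z in E by ring. now symmetry. }
apply injective_projections; [exact (H F HF)|].
specialize (H (fun w => (- Ci) * F w)%C). cbv beta in H. rewrite !re_mult in H. simpl in H.
unfold Im in H. enough (- 0 * Re (F z) - - (1) * snd (F z) = - 0 * Re (F 0%C) - - (1) * snd (F 0%C)) by lra.
apply H. intros w Hw.
rewrite <- (Cmult_0_r (- Ci)). now apply Cdiff_scal, HF.
Qed.

(** The way a function known only to be differentiable acquires a Taylor series: it differs from the
    termwise primitive of its derivative by a constant, which is 0. *)
Lemma disk_pseries_of_derive (q : nat -> C) (F Q : C -> C) :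
  disk_pseries q Q -> (forall z, disk z -> Cdiff F z (Q z)) -> F 0%C = 0%C ->
  disk_pseries (coef_int q) F.
Proof.
intros HQ HF HF0. destruct (disk_pseries_primitive q Q HQ) as [G [HG [HG0 HG']]].
eapply disk_pseries_ext; [reflexivity| |exact HG].
intros z Hz. apply Ceq_minus.
assert (E := Cdiff_zero_const (fun w => G w + (-1) * F w)%C z). cbv beta in E.
rewrite HG0, HF0 in E.
replace (G z - F z)%C with (G z + (-1) * F z)%C by ring.
rewrite E; [ring| |exact Hz].
intros w Hw. replace (RtoC 0) with (Q w + (-1) * Q w)%C by ring.
apply Cdiff_plus; [now apply HG'|]. now apply Cdiff_scal, HF.
Qed.

(** * Harmonic maps with a canonical representation *)

Lemma locally_2d_disk (x y : R) : disk (x, y) -> locally_2d (fun u v => disk (u, v)) x y.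
Proof.
intros Hz. assert (Hd : 0 < (1 - Cmod (x, y)) / 2) by (unfold disk in Hz; lra).
exists (mkposreal _ Hd). intros u v Hu Hv. simpl in Hu, Hv.
apply disk_nbhd with (x, y).
change ((u, v) - (x, y))%C with ((u - x, v - y) : C).
eapply Rle_lt_trans; [apply Cmod_le_Rabs_plus|]. lra.
Qed.

Lemma continuity_2d_Re (F : C -> C) (x y : R) (l : C) :
  Cdiff F (x, y) l -> continuity_2d_pt (fun u v => Re (F (u, v))) x y.
Proof.
intros H. destruct (Cdiff_bounded _ _ _ H) as [d [Hd Hb]].
set (L := Cmod l + 1) in *.
assert (HL : 0 < L) by (unfold L; assert (T := Cmod_ge_0 l); lra).
intros eps.
assert (Hpos : 0 < Rmin d (eps / L) / 2).
{ apply Rdiv_lt_0_compat; [|lra]. apply Rmin_pos; [exact Hd|].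
  apply Rdiv_lt_0_compat; [apply cond_pos|exact HL]. }
exists (mkposreal _ Hpos). intros u v Hu Hv. simpl in Hu, Hv.
assert (Hc : Cmod ((u, v) - (x, y)) < Rmin d (eps / L)).
{ change ((u, v) - (x, y))%C with ((u - x, v - y) : C).
  eapply Rle_lt_trans; [apply Cmod_le_Rabs_plus|]. lra. }
assert (M1 := Rmin_l d (eps / L)). assert (M2 := Rmin_r d (eps / L)).
specialize (Hb (u, v) ltac:(lra)).
rewrite <- Re_minus. eapply Rle_lt_trans; [apply re_le_Cmod|].
eapply Rle_lt_trans; [exact Hb|].
apply Rlt_le_trans with (L * (eps / L)); [apply Rmult_lt_compat_l; lra|].
apply Req_le. field. lra.
Qed.

(** The induction closes because the partial derivatives of Re F are Re F' and Re (i F'), again real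
    parts of power series. *)
Lemma ex_diff_n_Re (n : nat) (a : nat -> C) (F : C -> C) (x y : R) :
  disk_pseries a F -> disk (x, y) -> ex_diff_n (fun u v => Re (F (u, v))) n x y.
Proof.
revert a F. induction n as [|n IH]; intros a F HF Hz;
  destruct (disk_pseries_derive a F HF) as [HF' HD].
- split; [|exact I]. now apply continuity_2d_Re with (C_derive F (x, y)), HD.
- split; [now apply continuity_2d_Re with (C_derive F (x, y)), HD|].
  destruct (Cdiff_partials F x y _ (HD _ Hz)) as [Dx [Dy _]].
  split; [eexists; exact Dx|]. split; [eexists; exact Dy|]. split.
  + apply ex_diff_n_ext_loc with (fun u v => Re (C_derive F (u, v))); [|now apply (IH _ _ HF')].
    destruct (locally_2d_disk x y Hz) as [d Hd]. exists d. intros u v Hu Hv.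
    symmetry. apply is_derive_unique. now apply (Cdiff_partials F u v _ (HD _ (Hd u v Hu Hv))).
  + apply ex_diff_n_ext_loc with (fun u v => Re ((fun z => Ci * C_derive F z)%C (u, v))).
    * destruct (locally_2d_disk x y Hz) as [d Hd]. exists d. intros u v Hu Hv.
      symmetry. apply is_derive_unique.
      replace (Re (Ci * C_derive F (u, v))%C) with (- Im (C_derive F (u, v)))
        by (rewrite Cmult_comm, re_mult_Ci; reflexivity).
      now apply (Cdiff_partials F u v _ (HD _ (Hd u v Hu Hv))).
    * now apply (IH _ _ (disk_pseries_scal Ci _ _ HF')).
Qed.

Lemma laplacian_Re (a : nat -> C) (F : C -> C) (x y : R) :
  disk_pseries a F -> disk (x, y) -> laplacian (fun u v => Re (F (u, v))) x y = 0.
Proof.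
intros HF Hz.
destruct (disk_pseries_derive a F HF) as [HF' HD].
destruct (disk_pseries_derive _ _ HF') as [_ HD'].
destruct (locally_2d_disk x y Hz) as [d Hd].
set (l := C_derive (C_derive F) (x, y)).
destruct (Cdiff_partials _ x y _ (HD' _ Hz)) as [Dx [_ [_ Dy]]]. fold l in Dx, Dy.
assert (E1 : partial_derive 2 0 (fun u v => Re (F (u, v))) x y = Re l).
{ unfold partial_derive. simpl.
  rewrite (Derive_ext_loc _ (fun t => Re (C_derive F (t, y)))); [now apply is_derive_unique|].
  exists d. intros t Ht. apply is_derive_unique.
  apply (Cdiff_partials F t y). apply HD, Hd; [exact Ht|].
  rewrite Rminus_diag, Rabs_R0. apply cond_pos. }
assert (E2 : partial_derive 0 2 (fun u v => Re (F (u, v))) x y = - Re l).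
{ unfold partial_derive. simpl.
  rewrite (Derive_ext_loc _ (fun t => - Im (C_derive F (x, t)))).
  - apply is_derive_unique. exact (is_derive_opp _ _ _ Dy).
  - exists d. intros t Ht. apply is_derive_unique.
    apply (Cdiff_partials F x t). apply HD, Hd; [|exact Ht].
    rewrite Rminus_diag, Rabs_R0. apply cond_pos. }
unfold laplacian. rewrite E1, E2. ring.
Qed.

Lemma laplacian_ext_loc (u v : R -> R -> R) (x y : R) :
  locally_2d (fun s t => u s t = v s t) x y -> laplacian u x y = laplacian v x y.
Proof.
intros [d Hd]. unfold laplacian, partial_derive.
assert (Z : forall c : R, Rabs (c - c) < d) by (intros c; rewrite Rminus_diag, Rabs_R0; apply cond_pos).
f_equal; [|change (Derive_n (fun t => u x t) 2 y = Derive_n (fun t => v x t) 2 y)];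
  apply Derive_n_ext_loc; exists d; intros t Ht; simpl; apply Hd; auto.
Qed.

(** Both coordinates are real parts of power series: Re f = Re (H + G) and Im f = Re (-i (H -
    G)). *)
Lemma harmonic_of_disk_pseries (a b : nat -> C) (F H G : C -> C) :
  disk_pseries a H -> disk_pseries b G ->
  (forall z, disk z -> F z = H z + Cconj (G z))%C -> harmonic F.
Proof.
intros HH HG HF x y Hz.
assert (HS := disk_pseries_plus _ _ _ _ HH HG).
assert (HT := disk_pseries_scal (- Ci)%C _ _
  (disk_pseries_plus _ _ _ _ HH (disk_pseries_scal (-1)%C _ _ HG))).
cbv beta in HS, HT.
assert (ES : locally_2d (fun u v => Re (H (u, v) + G (u, v))%C = re_part F u v) x y).
{ destruct (locally_2d_disk x y Hz) as [d Hd]. exists d. intros u v Hu Hv.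
  unfold re_part. rewrite (HF _ (Hd u v Hu Hv)), !re_plus, re_conj. reflexivity. }
assert (ET : locally_2d (fun u v => Re (- Ci * (H (u, v) + (-1) * G (u, v)))%C = im_part F u v) x y).
{ destruct (locally_2d_disk x y Hz) as [d Hd]. exists d. intros u v Hu Hv.
  unfold im_part. rewrite (HF _ (Hd u v Hu Hv)).
  rewrite im_plus, im_conj, !re_mult, !re_plus, !im_plus, im_mult. simpl. ring. }
split; [exact (ex_diff_n_ext_loc _ _ 2 x y ES (ex_diff_n_Re 2 _ _ x y HS Hz))|].
split; [exact (ex_diff_n_ext_loc _ _ 2 x y ET (ex_diff_n_Re 2 _ _ x y HT Hz))|].
split.
- rewrite <- (laplacian_ext_loc _ _ x y ES). exact (laplacian_Re _ _ x y HS Hz).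
- rewrite <- (laplacian_ext_loc _ _ x y ET). exact (laplacian_Re _ _ x y HT Hz).
Qed.

Lemma d_xy_of_rep (F H G : C -> C) (z p q : C) :
  (forall w, disk w -> F w = H w + Cconj (G w))%C -> disk z ->
  Cdiff H z p -> Cdiff G z q ->
  d_x F z = (p + Cconj q)%C /\ d_y F z = (Ci * (p - Cconj q))%C.
Proof.
intros HF Hz HH HG. destruct z as [x y].
destruct (Cdiff_partials H x y p HH) as [H1 [H2 [H3 H4]]].
destruct (Cdiff_partials G x y q HG) as [G1 [G2 [G3 G4]]].
destruct (locally_2d_disk x y Hz) as [d Hd].
assert (Z : forall c : R, Rabs (c - c) < d) by (intros c; rewrite Rminus_diag, Rabs_R0; apply cond_pos).
assert (Exr : Derive (fun t : R => Re (F (t, y))) x = Re p + Re q).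
{ apply is_derive_unique. eapply is_derive_ext_loc; [|exact (is_derive_plus _ _ _ _ _ H1 G1)].
  exists d. intros t Ht. rewrite HF by (apply Hd; auto). now rewrite re_plus, re_conj. }
assert (Exi : Derive (fun t : R => Im (F (t, y))) x = Im p - Im q).
{ apply is_derive_unique. eapply is_derive_ext_loc; [|exact (is_derive_minus _ _ _ _ _ H3 G3)].
  exists d. intros t Ht. rewrite HF by (apply Hd; auto). now rewrite im_plus, im_conj. }
assert (Eyr : Derive (fun t : R => Re (F (x, t))) y = - Im p + - Im q).
{ apply is_derive_unique. eapply is_derive_ext_loc; [|exact (is_derive_plus _ _ _ _ _ H2 G2)].
  exists d. intros t Ht. rewrite HF by (apply Hd; auto). now rewrite re_plus, re_conj. }
assert (Eyi : Derive (fun t : R => Im (F (x, t))) y = Re p - Re q).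
{ apply is_derive_unique. eapply is_derive_ext_loc; [|exact (is_derive_minus _ _ _ _ _ H4 G4)].
  exists d. intros t Ht. rewrite HF by (apply Hd; auto). now rewrite im_plus, im_conj. }
unfold d_x, d_y, re_part, im_part. simpl. rewrite Exr, Exi, Eyr, Eyi.
split; apply injective_projections; simpl; unfold Re, Im; ring.
Qed.

Lemma d_z_of_rep (F H G : C -> C) (z p q : C) :
  (forall w, disk w -> F w = H w + Cconj (G w))%C -> disk z ->
  Cdiff H z p -> Cdiff G z q -> d_z F z = p /\ d_zbar F z = Cconj q.
Proof.
intros HF Hz HH HG. unfold d_z, d_zbar.
destruct (d_xy_of_rep F H G z p q HF Hz HH HG) as [-> ->].
assert (E : (Ci * Ci)%C = (-1)%C) by (apply injective_projections; simpl; ring).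
split.
- replace (p + Cconj q - Ci * (Ci * (p - Cconj q)))%C
    with (p + Cconj q - (Ci * Ci) * (p - Cconj q))%C by ring.
  rewrite E. field.
- replace (p + Cconj q + Ci * (Ci * (p - Cconj q)))%C
    with (p + Cconj q + (Ci * Ci) * (p - Cconj q))%C by ring.
  rewrite E. field.
Qed.

Lemma jacobian_of_rep (F H G : C -> C) (z p q : C) :
  (forall w, disk w -> F w = H w + Cconj (G w))%C -> disk z ->
  Cdiff H z p -> Cdiff G z q -> jacobian F z = Cmod p ^ 2 - Cmod q ^ 2.
Proof.
intros HF Hz HH HG. unfold jacobian.
destruct (d_xy_of_rep F H G z p q HF Hz HH HG) as [-> ->].
rewrite !Cmod2_alt. unfold Re, Im; simpl. ring.
Qed.

Lemma Cmod_lt_sqr (p q : C) : Cmod q < Cmod p <-> 0 < Cmod p ^ 2 - Cmod q ^ 2.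
Proof. assert (P := Cmod_ge_0 p). assert (Q := Cmod_ge_0 q). split; intros; nra. Qed.

(** * The Cayley transform between half plane and disk *)

(** Everything rests on |1 + u|^2 - |u|^2 = 2 Re u + 1. The point u = -1, where the quotient carries
    no information, is excluded separately. *)
Lemma disk_cayley (u : C) :
  -1/2 < Re u <-> (1 + u)%C <> 0%C /\ disk (u / (1 + u))%C.
Proof.
assert (E : Cmod (1 + u)%C ^ 2 - Cmod u ^ 2 = 2 * Re u + 1)
  by (rewrite !Cmod2_alt; unfold Re, Im; simpl; ring).
split.
- intros H. assert (L : Cmod u < Cmod (1 + u)%C) by (apply Cmod_lt_sqr; lra).
  assert (N : (1 + u)%C <> 0%C) by (apply Cmod_gt_0; eapply Rle_lt_trans; [apply Cmod_ge_0|exact L]).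
  split; [exact N|]. unfold disk. rewrite Cmod_div by exact N.
  assert (P := Cmod_ge_0 u).
  apply Rmult_lt_reg_r with (Cmod (1 + u)%C); [lra|].
  unfold Rdiv. rewrite Rmult_assoc, Rinv_l; lra.
- intros [N H]. unfold disk in H. rewrite Cmod_div in H by exact N.
  apply Cmod_gt_0 in N.
  apply (Rmult_lt_compat_r (Cmod (1 + u)%C)) in H; [|exact N].
  unfold Rdiv in H. rewrite Rmult_assoc, Rinv_l, Rmult_1_l, Rmult_1_r in H by lra.
  apply Cmod_lt_sqr in H. lra.
Qed.

Lemma disk_neq_1 (z : C) : disk z -> (1 - z)%C <> 0%C.
Proof.
intros Hz H. assert (E : z = 1%C) by (replace z with (1 - (1 - z))%C by ring; rewrite H; ring).
unfold disk in Hz. rewrite E, Cmod_1 in Hz. lra.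
Qed.

Lemma cayley_inverse (z : C) : disk z ->
  -1/2 < Re (z / (1 - z))%C /\ (z / (1 - z) / (1 + z / (1 - z)))%C = z.
Proof.
intros Hz. assert (N := disk_neq_1 z Hz).
assert (E1 : (1 + z / (1 - z))%C = (/ (1 - z))%C) by (field; exact N).
assert (N1 : (1 + z / (1 - z))%C <> 0%C).
{ rewrite E1. intros E. apply C1_nz. rewrite <- (Cinv_r _ N), E. ring. }
assert (E2 : (z / (1 - z) / (1 + z / (1 - z)))%C = z) by (rewrite E1; field; exact N).
split; [|exact E2]. apply disk_cayley. split; [exact N1|]. now rewrite E2.
Qed.

(** The half plane statement transported by z = u/(1+u). Since dz/du = (1-z)^2, the last hypothesis
    is the lower bound Re u + 1/2 for the real part of d(H-G)/du. *)
Lemma shear_disk (F H G H' G' : C -> C) :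
  (forall z, disk z -> F z = H z + Cconj (G z))%C ->
  (forall z, disk z -> Cdiff H z (H' z)) ->
  (forall z, disk z -> Cdiff G z (G' z)) ->
  (forall z, disk z -> Cmod (G' z) < Cmod (H' z)) ->
  (forall z, disk z ->
     Re (z / (1 - z))%C + 1/2 <= Re ((1 - z) ^ 2 * (H' z - G' z))%C) ->
  convex_in_real_direction F.
Proof.
intros HF HH HG HJ HR.
set (phi := fun u : C => (u / (1 + u))%C).
assert (Hphi : forall u, -1/2 < Re u -> Cdiff phi u ((1 - phi u) ^ 2)%C).
{ intros u Hu. apply disk_cayley in Hu. destruct Hu as [N _]. unfold phi.
  replace ((1 - u / (1 + u)) ^ 2)%C
    with (1 * / (1 + u) + u * (- / ((1 + u) * (1 + u)) * (0 + 1)))%C by (field; exact N).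
  apply (Cdiff_mult (fun u => u) (fun u => / (1 + u))%C); [apply Cdiff_id|].
  apply (Cdiff_comp Cinv (fun u => 1 + u)%C); [now apply Cdiff_inv|].
  apply Cdiff_plus; [apply Cdiff_const|apply Cdiff_id]. }
assert (Hdisk : forall u, -1/2 < Re u -> disk (phi u)) by (intros u Hu; now apply disk_cayley).
assert (Hback : forall u, -1/2 < Re u -> (phi u / (1 - phi u))%C = u).
{ intros u Hu. apply disk_cayley in Hu. destruct Hu as [N _]. unfold phi. field.
  split; [exact N|]. replace (1 + u - u)%C with (RtoC 1) by ring. exact C1_nz. }
destruct (halfplane_shear
  (fun u => H (phi u) + (-1) * G (phi u))%C
  (fun u => (H' (phi u) + (-1) * G' (phi u)) * (1 - phi u) ^ 2)%C
  (fun u => H (phi u) + G (phi u))%C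
  (fun u => (H' (phi u) + G' (phi u)) * (1 - phi u) ^ 2)%C (-1/2)) as [Hinj Hconn].
- intros u Hu. apply (Cdiff_comp (fun z => H z + (-1) * G z)%C phi); [|now apply Hphi].
  apply Cdiff_plus; [now apply HH, Hdisk|].
  now apply Cdiff_scal, HG, Hdisk.
- intros u Hu. apply (Cdiff_comp (fun z => H z + G z)%C phi); [|now apply Hphi].
  apply Cdiff_plus; [now apply HH, Hdisk|now apply HG, Hdisk].
- intros u Hu. specialize (HR _ (Hdisk u Hu)). rewrite (Hback u Hu) in HR.
  replace ((H' (phi u) + -1 * G' (phi u)) * (1 - phi u) ^ 2)%C
    with ((1 - phi u) ^ 2 * (H' (phi u) - G' (phi u)))%C by ring. lra.
- intros u Hu. specialize (HJ _ (Hdisk u Hu)). apply Cmod_lt_sqr in HJ.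
  assert (N := disk_neq_1 _ (Hdisk u Hu)).
  apply (Cpow_nz _ 2), Cmod_gt_0 in N. set (k := ((1 - phi u) ^ 2)%C) in *.
  set (p := H' (phi u)) in *. set (q := G' (phi u)) in *.
  assert (Hk : 0 < Cmod k ^ 2) by (apply pow_lt; exact N).
  (* In (p + q) conj(p - q) the mixed terms q conj(p) - p conj(q) are purely imaginary, and [k]
     enters only through |k|^2. *)
  replace (Re ((p + q) * k * Cconj ((p + -1 * q) * k)))%C
    with (Cmod k ^ 2 * (Cmod p ^ 2 - Cmod q ^ 2)).
  + now apply Rmult_lt_0_compat.
  + rewrite !Cmod2_alt. unfold Re, Im; simpl. ring.
- assert (HRe : forall z, disk z -> Re (F z) = Re (H z + G z)%C).
  { intros z Hz. rewrite (HF z Hz), !re_plus, re_conj. reflexivity. }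
  assert (HIm : forall z, disk z -> Im (F z) = Im (H z + (-1) * G z)%C).
  { intros z Hz. rewrite (HF z Hz), !im_plus, im_conj, im_mult. simpl. ring. }
  assert (Hcay : forall z, disk z -> exists u, -1/2 < Re u /\ phi u = z).
  { intros z Hz. exists (z / (1 - z))%C. now apply cayley_inverse. }
  split.
  + intros z w Hz Hw E.
    destruct (Hcay z Hz) as [u [Hu Eu]]. destruct (Hcay w Hw) as [v [Hv Ev]].
    rewrite <- Eu, <- Ev. f_equal. apply Hinj; [exact Hu|exact Hv| |]; rewrite Eu, Ev.
    * rewrite <- (HRe z Hz), <- (HRe w Hw). now rewrite E.
    * rewrite <- (HIm z Hz), <- (HIm w Hw). now rewrite E.
  + intros c. specialize (Hconn c).
    match type of Hconn with connected ?A =>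
      replace (fun w => image F w /\ Im w = c) with A; [exact Hconn|] end.
    apply functional_extensionality. intros w.
    apply propositional_extensionality.
    assert (Epair : forall z, disk z -> (Re (H z + G z)%C, Im (H z + (-1) * G z)%C) = F z).
    { intros z Hz. rewrite <- (HRe z Hz), <- (HIm z Hz). now destruct (F z). }
    split; intros [[z [Hz E]] Ec]; (split; [|exact Ec]).
    * exists (phi z). split; [now apply Hdisk|]. rewrite <- Epair; [exact E|now apply Hdisk].
    * destruct (Hcay z Hz) as [u [Hu Eu]]. exists u. split; [exact Hu|].
      rewrite Eu, Epair; [exact E|exact Hz].
Qed.

(** * Convolution with the half-plane mapping *)

Definition coef_one (n : nat) : C := match n with O => 1%C | S _ => 0%C end.

Lemma disk_pseries_one : disk_pseries coef_one (fun _ => 1%C).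
Proof.
split.
- intros r Hr. exists 1. intros [|n]; simpl.
  + rewrite Cmod_1. lra.
  + rewrite Cmod_0. lra.
- intros z _. replace (RtoC 1) with (coef_one 0 * z ^ 0 + 0)%C by (simpl; ring).
  apply (Cseries_decr_1 (fun n => coef_one n * z ^ n)%C).
  apply (Cseries_ext (fun _ => 0%C)); [intros n; simpl; ring|exact Cseries_0].
Qed.

Lemma Cmod_1_le : Cmod 1%C <= 1.
Proof. rewrite Cmod_1. lra. Qed.

Lemma disk_pseries_geom :
  disk_pseries (fun _ => 1%C) (fun z => 1 / (1 - z))%C.
Proof.
eapply disk_pseries_ext; [| |exact (disk_pseries_div 1 _ _ Cmod_1_le disk_pseries_one)].
- induction n as [|n IH]; [reflexivity|]. simpl in *. rewrite IH. ring.
- intros z Hz. cbv beta. f_equal. ring.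
Qed.

Lemma disk_pseries_geom2 :
  disk_pseries (fun n => RtoC (INR (S n))) (fun z => 1 / (1 - z) / (1 - z))%C.
Proof.
eapply disk_pseries_ext; [| |exact (disk_pseries_div 1 _ _ Cmod_1_le disk_pseries_geom)].
- induction n as [|n IH]; [reflexivity|].
  change (coef_geom 1 (fun _ => 1%C) (S n)) with (1 * coef_geom 1 (fun _ => 1%C) n + 1)%C.
  rewrite IH, (S_INR (S n)), RtoC_plus. ring.
- intros z Hz. cbv beta. f_equal. ring.
Qed.

(** The value s = 1 gives [h0] and s = -1 gives [g0]. The coefficients (1 + s n)/2 for n >= 1 are
    what makes the Hadamard product with F equal to (F + s z F')/2. *)
Lemma disk_pseries_kernel (s : R) :
  disk_pseries
    (fun n => coef_shift (fun k => / 2 * (1 + s * INR (S k))) n)%C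
    (fun z => / 2 * (z / (1 - z) + s * (z / (1 - z) ^ 2)))%C.
Proof.
eapply disk_pseries_ext; [| |exact (disk_pseries_mulz _ _ (disk_pseries_scal (/ 2)%C _ _
  (disk_pseries_plus _ _ _ _ disk_pseries_geom (disk_pseries_scal s _ _ disk_pseries_geom2))))].
- reflexivity.
- intros z Hz. assert (N := disk_neq_1 z Hz). cbv beta. field. exact N.
Qed.

Lemma conv_kernel (k F : C -> C) (s : R) (b : nat -> C) :
  (forall z, disk z -> k z = / 2 * (z / (1 - z) + s * (z / (1 - z) ^ 2)))%C ->
  disk_pseries b F ->
  F 0%C = 0%C ->
  (exists c, disk_pseries c (conv k F)) /\
  forall z, disk z -> conv k F z = (/ 2 * (F z + s * (z * C_derive F z)))%C.
Proof.
intros Hk HF HF0. destruct (disk_pseries_derive b F HF) as [HF' _].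
assert (Hb0 : b 0%nat = 0%C) by now rewrite <- (disk_pseries_at_0 b F HF).
assert (HK : disk_pseries (fun n => coef_shift (fun k => / 2 * (1 + s * INR (S k))) n)%C k).
{ eapply disk_pseries_ext; [reflexivity| |exact (disk_pseries_kernel s)].
  intros z Hz. now rewrite Hk. }
assert (HG := disk_pseries_scal (/ 2)%C _ _
  (disk_pseries_plus _ _ _ _ HF (disk_pseries_scal s _ _ (disk_pseries_mulz _ _ HF')))).
cbv beta in HG.
assert (HG' : disk_pseries
  (fun n => coef_shift (fun k => / 2 * (1 + s * INR (S k))) n * b n)%C
  (fun z => / 2 * (F z + s * (z * C_derive F z)))%C).
{ eapply disk_pseries_ext; [| |exact HG]; [|reflexivity].
  intros [|n]; unfold coef_shift, coef_derive; [rewrite Hb0|]; ring. }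
assert (E : forall z, disk z -> conv k F z = (/ 2 * (F z + s * (z * C_derive F z)))%C).
{ intros z Hz. exact (conv_disk_pseries _ _ _ _ _ z HK HF HG' eq_refl Hz). }
split; [|exact E]. eexists.
eapply disk_pseries_ext; [reflexivity| |exact HG']. intros z Hz. symmetry. now apply E.
Qed.

Lemma Cdiff_conv_kernel (k F : C -> C) (s : R) (b : nat -> C) (z : C) :
  (forall z, disk z -> k z = / 2 * (z / (1 - z) + s * (z / (1 - z) ^ 2)))%C ->
  disk_pseries b F -> F 0%C = 0%C -> disk z ->
  Cdiff (conv k F) z
    (/ 2 * (C_derive F z + s * (C_derive F z + z * C_derive (C_derive F) z)))%C.
Proof.
intros Hk HF HF0 Hz.
destruct (conv_kernel k F s b Hk HF HF0) as [_ E].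
destruct (disk_pseries_derive b F HF) as [HF' D]. destruct (disk_pseries_derive _ _ HF') as [_ D'].
apply (Cdiff_ext_disk (fun z => / 2 * (F z + s * (z * C_derive F z)))%C);
  [intros w Hw; symmetry; now apply E|exact Hz|].
apply (Cdiff_scal (/ 2)%C (fun z => F z + s * (z * C_derive F z))%C).
apply Cdiff_plus; [now apply D|].
apply (Cdiff_scal s (fun z => z * C_derive F z)%C).
replace (C_derive F z + z * C_derive (C_derive F) z)%C
  with (1 * C_derive F z + z * C_derive (C_derive F) z)%C by ring.
apply (Cdiff_mult (fun z => z)); [apply Cdiff_id|now apply D'].
Qed.

Lemma h0_partial_fractions (z : C) : disk z ->
  h0 z = (/ 2 * (z / (1 - z) + 1%R * (z / (1 - z) ^ 2)))%C.
Proof. intros Hz. assert (N := disk_neq_1 z Hz). unfold h0. field. exact N. Qed.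

Lemma g0_partial_fractions (z : C) : disk z ->
  g0 z = (/ 2 * (z / (1 - z) + (-1)%R * (z / (1 - z) ^ 2)))%C.
Proof. intros Hz. assert (N := disk_neq_1 z Hz). unfold g0. field. exact N. Qed.

(** * Dilatation and derivatives of the shear *)

Lemma Cmod_expi (t : R) : Cmod (expi t) = 1.
Proof.
unfold expi, Cmod. simpl. assert (H := sin2_cos2 t). unfold Rsqr in H.
rewrite <- sqrt_1 at 3. f_equal. lra.
Qed.

Lemma one_plus_neq_0 (w : C) : Cmod w < 1 -> (1 + w)%C <> 0%C.
Proof.
intros H E. assert (E' : w = (- (1))%C) by (replace w with ((1 + w) - 1)%C by ring; rewrite E; ring).
rewrite E', Cmod_opp, Cmod_1 in H. lra.
Qed.

Lemma disk_pow (n : nat) (z : C) : disk z -> (0 < n)%nat -> Cmod z ^ n < 1.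
Proof.
unfold disk. intros Hz Hn. assert (P := Cmod_ge_0 z).
destruct n as [|n]; [lia|]. simpl.
assert (Cmod z ^ n <= 1) by (rewrite <- (pow1 n); apply pow_incr; lra).
assert (0 <= Cmod z ^ n) by now apply pow_le.
nra.
Qed.

Lemma Cmod_dilatation (t : R) (n : nat) (z : C) :
  disk z -> (0 < n)%nat -> Cmod (expi t * z ^ n)%C < 1.
Proof.
intros Hz Hn. rewrite Cmod_mult, Cmod_expi, Cmod_pow, Rmult_1_l. now apply disk_pow.
Qed.

(** For n = 2: with c^2 = -e, the denominator 1 + e z^2 splits into (1 - c z)(1 + c z), and each
    factor can be divided out of a power series. The witness halves the argument of -e. *)
Lemma neg_expi_sqrt (t : R) : exists c : C, Cmod c = 1 /\ (c * c)%C = (- expi t)%C.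
Proof.
exists (expi ((t + PI) / 2)); split; [apply Cmod_expi|].
assert (E : t + PI = 2 * ((t + PI) / 2)) by field.
assert (Hc : cos (2 * ((t + PI) / 2)) = - cos t) by (rewrite <- E; apply neg_cos).
assert (Hs : sin (2 * ((t + PI) / 2)) = - sin t) by (rewrite <- E; apply neg_sin).
rewrite cos_2a in Hc. rewrite sin_2a in Hs.
apply injective_projections; simpl; lra.
Qed.

Lemma disk_pseries_shear_derivative (n : nat) (t : R) :
  n = 1%nat \/ n = 2%nat ->
  exists q, disk_pseries q (fun z => 1 / (1 - z) / (1 - z) / (1 + expi t * z ^ n))%C.
Proof.
intros Hn. assert (Hg := disk_pseries_geom2). destruct Hn as [-> | ->].
- eexists. eapply disk_pseries_ext; [reflexivity| |
    exact (disk_pseries_div (- expi t)%C _ _ ltac:(rewrite Cmod_opp, Cmod_expi; lra) Hg)].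
  intros z Hz. cbv beta. f_equal. simpl. ring.
- destruct (neg_expi_sqrt t) as [c [Hc Ec]].
  eexists. eapply disk_pseries_ext; [reflexivity| |
    exact (disk_pseries_div (- c)%C _ _ ltac:(rewrite Cmod_opp; lra)
      (disk_pseries_div c _ _ ltac:(lra) Hg))].
  intros z Hz. cbv beta.
  assert (Hcz : Cmod (c * z)%C < 1) by (rewrite Cmod_mult, Hc, Rmult_1_l; exact Hz).
  assert (N := disk_neq_1 z Hz).
  assert (N1 := one_plus_neq_0 _ Hcz).
  assert (N2 : (1 - c * z)%C <> 0%C).
  { unfold Cminus. apply one_plus_neq_0. now rewrite Cmod_opp. }
  replace (1 + expi t * z ^ 2)%C with ((1 - c * z) * (1 + c * z))%C.
  + field. repeat split; auto.
  + replace (expi t) with (- (- expi t))%C by ring. rewrite <- Ec. ring.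
Qed.

Lemma Cdiff_monomial (c z : C) (n : nat) :
  Cdiff (fun w => c * w ^ S n)%C z (c * (INR (S n) * z ^ n))%C.
Proof.
apply (Cdiff_scal c (fun w => w ^ S n)%C).
induction n as [|n IH].
- replace (INR 1 * z ^ 0)%C with (RtoC 1) by (simpl; ring).
  apply (Cdiff_ext_loc (fun w => w) _ z 1%C 1); [lra| |apply Cdiff_id].
  intros w _. simpl. ring.
- replace (INR (S (S n)) * z ^ S n)%C with (1 * z ^ S n + z * (INR (S n) * z ^ n))%C
    by (rewrite (S_INR (S n)), RtoC_plus; simpl; ring).
  apply (Cdiff_mult (fun w => w) (fun w => w ^ S n)%C); [apply Cdiff_id|exact IH].
Qed.

(** After clearing |1 + w|^2 the claim is |1 + w|^2 <= 2 (1 + Re w), that is, |w| <= 1. *)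
Lemma half_le_Re_inv_one_plus (w : C) : Cmod w < 1 -> 1 / 2 <= Re (/ (1 + w))%C.
Proof.
intros H. assert (N := one_plus_neq_0 w H). apply Cmod_gt_0 in N.
assert (P := Cmod_ge_0 w).
assert (H2 : Cmod w ^ 2 < 1) by nra.
assert (N2 : 0 < Cmod (1 + w)%C ^ 2) by (now apply pow_lt).
rewrite Cmod2_alt in H2, N2. destruct w as [x y]. simpl in *.
replace (1 / 2) with ((((1 + x) * (1 + x) + (0 + y) * (0 + y)) / 2) /
  ((1 + x) * (1 + x) + (0 + y) * (0 + y))) by (field; nra).
replace ((1 + x) * ((1 + x) * 1) + (0 + y) * ((0 + y) * 1))
  with ((1 + x) * (1 + x) + (0 + y) * (0 + y)) by ring.
unfold Rdiv. apply Rmult_le_compat_r; [apply Rlt_le, Rinv_0_lt_compat; nra|]. nra.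
Qed.

(* Up to constants the two sides are [|p|] and [|p*|], where
   [p = z^2 + a z + a], [a] is the conjugate of [e/2], and [p*] is the
   reciprocal polynomial of [p]; one Schur-Cohn step bounds the difference of
   their squares below by a nonnegative multiple of [1 - |z|^2]. *)
Lemma schur_cohn_quadratic (e z : C) :
  Cmod e = 1 -> disk z ->
  Cmod (1 + z + 2 * e * z ^ 2)%C <= Cmod (2 + e * z + e * z ^ 2)%C.
Proof.
intros He Hz. unfold disk in Hz.
assert (P := Cmod_ge_0 z).
assert (Hz2 : Cmod z ^ 2 < 1) by nra.
assert (He2 : Cmod e ^ 2 = 1) by (rewrite He; ring).
apply Rnot_lt_le. intros H. apply Cmod_lt_sqr in H. revert H. apply Rle_not_lt.
rewrite !Cmod2_alt. rewrite Cmod2_alt in Hz2, He2.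
destruct e as [a b], z as [x y]. simpl in *.
assert (Hb : b * b = 1 - a * a) by lra.
(* Put q = 3 + (2e - 1) z, which is 4 times p* minus e/2 times p. The Schur step gives 3 (|2 + e z +
   e z^2|^2 - |1 + z + 2 e z^2|^2) = (1 - |z|^2) (|q|^2 + 4 |z|^2 (1 + Re e)). [D] is the right side
   in coordinates, where [a] and [b] now denote Re e and Im e. *)
set (D := (1 - (x * x + y * y)) *
  (((3 + (2 * a - 1) * x - 2 * b * y) ^ 2 + ((2 * a - 1) * y + 2 * b * x) ^ 2)
   + 4 * (x * x + y * y) * (1 + a))).
assert (Ha : 0 <= 1 + a) by nra.
assert (HD : 0 <= D).
{ unfold D. apply Rmult_le_pos; [lra|]. apply Rplus_le_le_0_compat.
  - apply Rplus_le_le_0_compat; apply pow2_ge_0.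
  - apply Rmult_le_pos; [nra|exact Ha]. }
match goal with |- ?l <= 0 => assert (E : 3 * l = - D) by (unfold D; ring [Hb]) end.
lra.
Qed.

Lemma Cdiff_one_minus (z : C) : Cdiff (fun w => 1 + (-1) * w)%C z (0 + (-1) * 1)%C.
Proof.
apply Cdiff_plus; [apply Cdiff_const|].
apply (Cdiff_scal (-1)%C (fun w => w)), Cdiff_id.
Qed.

Lemma shear_derivative (h g om : C -> C) (z : C) :
  (forall z, disk z -> (h z + g z)%C = (z / (1 - z))%C) ->
  Cdiff h z (C_derive h z) -> Cdiff g z (C_derive g z) ->
  disk z -> C_derive g z = (om z * C_derive h z)%C -> (1 + om z)%C <> 0%C ->
  C_derive h z = (1 / (1 - z) / (1 - z) / (1 + om z))%C.
Proof.
intros Hsum Dh Dg Hz Hg Hom. assert (N := disk_neq_1 z Hz).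
(* The identity (h + g)(1 - z) = z is differentiated, which needs only the product rule. *)
assert (D1 := Cdiff_mult _ _ _ _ _ (Cdiff_plus _ _ _ _ _ Dh Dg) (Cdiff_one_minus z)).
cbv beta in D1.
assert (D2 : Cdiff (fun w => w) z
  ((C_derive h z + C_derive g z) * (1 + (-1) * z) + (h z + g z) * (0 + (-1) * 1))%C).
{ eapply Cdiff_ext_disk; [|exact Hz|exact D1].
  intros w Hw. cbv beta. rewrite (Hsum w Hw). field. exact (disk_neq_1 w Hw). }
assert (E := Cdiff_unique _ _ _ _ D2 (Cdiff_id z)). rewrite (Hsum z Hz), Hg in E.
assert (E' : ((1 + om z) * (1 - z) * (1 - z) * C_derive h z)%C = 1%C).
{ match type of E with ?l = _ =>
    transitivity ((l + z / (1 - z)) * (1 - z))%C; [|rewrite E] end; field; exact N. }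
replace (1 / (1 - z) / (1 - z) / (1 + om z))%C with
  (((1 + om z) * (1 - z) * (1 - z) * C_derive h z) / (1 - z) / (1 - z) / (1 + om z))%C
  by (rewrite E'; reflexivity).
field. split; [exact N|exact Hom].
Qed.

Lemma shear_second_derivative (p om : C -> C) (z p2 w1 : C) :
  (forall z, disk z -> (1 + om z)%C <> 0%C) ->
  (forall z, disk z -> p z = (1 / (1 - z) / (1 - z) / (1 + om z))%C) ->
  disk z -> Cdiff p z p2 -> Cdiff om z w1 ->
  p2 = ((2 * (1 + om z) - w1 * (1 - z)) / ((1 - z) * (1 - z) * (1 - z) * (1 + om z) * (1 + om z)))%C.
Proof.
intros Hom Hp Hz Dp Dom. assert (N := disk_neq_1 z Hz). assert (No := Hom z Hz).
(* Implicit differentiation of (1 + om)(1 - z)^2 p = 1. *)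
assert (D1 := Cdiff_mult _ _ _ _ _
  (Cdiff_mult _ _ _ _ _ (Cdiff_plus _ _ _ _ _ (Cdiff_const 1%C z) Dom)
    (Cdiff_mult _ _ _ _ _ (Cdiff_one_minus z) (Cdiff_one_minus z))) Dp).
cbv beta in D1.
eapply (Cdiff_ext_disk _ (fun _ => 1%C)) in D1; [|intros w Hw|exact Hz].
2:{ cbv beta. rewrite (Hp w Hw). field. split; [now apply disk_neq_1|now apply Hom]. }
assert (E := Cdiff_unique _ _ _ _ D1 (Cdiff_const 1%C z)). rewrite (Hp z Hz) in E.
(* [l] is 0 and is affine in [p2] with leading coefficient (1 + om z)(1 - z)^2; hence the quotient
   of [l] by this coefficient, minus [p2], is free of [p2]. *)
match type of E with ?l = _ =>
  transitivity (l / ((1 + om z) * (1 - z) * (1 - z)) - (l / ((1 + om z) * (1 - z) * (1 - z)) - p2))%C;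
  [ring|rewrite E at 1] end.
field. auto.
Qed.

(** * Dilatation of the convolution *)

(** [K] is a common denominator, so that G/H = W X / Y. The strictness comes from |W| < 1, and Y = H
    K being nonzero also shows that K is. *)
Lemma Cmod_lt_of_factors (G H K W X Y : C) :
  (G * K)%C = (W * X)%C -> (H * K)%C = Y -> Cmod W < 1 -> Cmod X <= Cmod Y ->
  Y <> 0%C -> Cmod G < Cmod H.
Proof.
intros EG EH HW HX HY.
apply Cmod_gt_0 in HY.
apply (f_equal Cmod) in EG, EH. rewrite !Cmod_mult in EG. rewrite Cmod_mult in EH.
assert (P := Cmod_ge_0 K). assert (PX := Cmod_ge_0 X). assert (PW := Cmod_ge_0 W).
assert (PG := Cmod_ge_0 G). assert (PH := Cmod_ge_0 H).
assert (Cmod W * Cmod X < Cmod Y) by nra.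
apply Rmult_lt_reg_r with (Cmod K); [|lra].
destruct P as [P|P]; [exact P|]. rewrite <- P in EH. lra.
Qed.

(* With [w = e z^n], [w1 = w'], [p = h'], [p2 = h''], the two sides below are
   [G'] and [H'] for [f_0 * f = H + conj G]. *)
Lemma convolution_dilatation (n : nat) (e z : C) :
  n = 1%nat \/ n = 2%nat -> Cmod e = 1 -> disk z ->
  let w := (e * z ^ n)%C in
  let w1 := (e * (INR n * z ^ pred n))%C in
  let p := (1 / (1 - z) / (1 - z) / (1 + w))%C in
  let p2 := ((2 * (1 + w) - w1 * (1 - z)) / ((1 - z) * (1 - z) * (1 - z) * (1 + w) * (1 + w)))%C in
  Cmod (/ 2 * (w * p + (-1)%R * (w * p + z * (w1 * p + w * p2))))%C <
  Cmod (/ 2 * (p + 1%R * (p + z * p2)))%C.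
Proof.
intros Hn He Hz w w1 p p2.
assert (N := disk_neq_1 z Hz).
assert (Hdil : forall k, (0 < k)%nat -> Cmod (e * z ^ k)%C < 1).
{ intros k Hk. rewrite Cmod_mult, He, Rmult_1_l, Cmod_pow. now apply disk_pow. }
assert (Nw : (1 + w)%C <> 0%C) by (apply one_plus_neq_0, Hdil; lia).
(* As z w1 = n w, clearing denominators gives H' K = 2 + (2 - n) w + n z w and G' K = - w (n + (2 -
   n) z + 2 z w). For n = 2 both parentheses become 2 (1 + z w); for n = 1 they form the pair of the
   Schur-Cohn estimate. *)
set (K := (2 * ((1 - z) * (1 - z) * (1 - z)) * (1 + w) * (1 + w))%C).
destruct Hn as [-> | ->].
- apply (Cmod_lt_of_factors _ _ K (- w) (1 + z + 2 * e * z ^ 2) (2 + e * z + e * z ^ 2))%C.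
  + unfold K, p, p2, w1, w. simpl.
    field. split; [|exact N]. intros E0. apply Nw. rewrite <- E0. unfold w. simpl. ring.
  + unfold K, p, p2, w1, w. simpl.
    field. split; [|exact N]. intros E0. apply Nw. rewrite <- E0. unfold w. simpl. ring.
  + rewrite Cmod_opp. apply Hdil; lia.
  + now apply schur_cohn_quadratic.
  + assert (H1 := Hdil 1%nat ltac:(lia)). assert (H2 := Hdil 2%nat ltac:(lia)).
    intros E0.
    assert (E1 : RtoC 2 = (- (e * z ^ 1 + e * z ^ 2))%C).
    { replace (RtoC 2) with ((2 + e * z + e * z ^ 2) - (e * z ^ 1 + e * z ^ 2))%C by ring.
      rewrite E0. ring. }
    apply (f_equal Cmod) in E1. rewrite Cmod_opp, Cmod_R, Rabs_pos_eq in E1 by lra.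
    assert (T := Cmod_triangle (e * z ^ 1)%C (e * z ^ 2)%C). lra.
- apply (Cmod_lt_of_factors _ _ K (- w) (2 * (1 + e * z ^ 3)) (2 * (1 + e * z ^ 3)))%C.
  + unfold K, p, p2, w1, w. simpl. rewrite RtoC_plus.
    field. split; [|exact N]. intros E0. apply Nw. rewrite <- E0. unfold w. simpl. ring.
  + unfold K, p, p2, w1, w. simpl. rewrite RtoC_plus.
    field. split; [|exact N]. intros E0. apply Nw. rewrite <- E0. unfold w. simpl. ring.
  + rewrite Cmod_opp. apply Hdil; lia.
  + lra.
  + apply Cmult_neq_0; [intros E0; apply RtoC_inj in E0; lra|].
    apply one_plus_neq_0, Hdil. lia.
Qed.

(** H' - G' = h' + z (h' + g')'/2 with h' + g' = (1-z)^(-2), so [w1] cancels and may be any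
    number. *)
Lemma convolution_real_part (z w w1 : C) :
  disk z -> Cmod w < 1 ->
  let p := (1 / (1 - z) / (1 - z) / (1 + w))%C in
  let p2 := ((2 * (1 + w) - w1 * (1 - z)) / ((1 - z) * (1 - z) * (1 - z) * (1 + w) * (1 + w)))%C in
  Re (z / (1 - z))%C + 1 / 2 <=
  Re ((1 - z) ^ 2 * (/ 2 * (p + 1%R * (p + z * p2)) -
      / 2 * (w * p + (-1)%R * (w * p + z * (w1 * p + w * p2)))))%C.
Proof.
intros Hz Hw p p2. assert (N := disk_neq_1 z Hz). assert (Nw := one_plus_neq_0 w Hw).
assert (H := half_le_Re_inv_one_plus w Hw).
match goal with |- _ <= Re ?x => replace x with (z / (1 - z) + / (1 + w))%C end.
- rewrite re_plus. lra.
- unfold p, p2. field. auto.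
Qed.

Theorem theorem3 :
  forall (n : nat) (theta : R) (f h g : C -> C),
    (0 < n)%nat ->
    KHO f ->
    canonical_rep f h g ->
    (forall z : C, disk z -> (h z + g z)%C = (z / (1 - z))%C) ->
    (forall z : C, disk z ->
       (C_derive g z / C_derive h z)%C = (expi theta * z ^ n)%C) ->
    n = 1%nat \/ n = 2%nat ->
    SHO (harmonic_conv h0 g0 h g) /\
    convex_in_real_direction (harmonic_conv h0 g0 h g).
Proof.
intros n theta f h g Hn [[_ [Hsp _]] _] [Ah [Ag [h00 [g00 Hrep]]]] Hsum Hdil Hn12.
set (om := fun z : C => (expi theta * z ^ n)%C) in *.
assert (Dh := fun z => analytic_Cdiff h z Ah). assert (Dg := fun z => analytic_Cdiff g z Ag).
assert (Hom : forall z, disk z -> Cmod (om z) < 1) by (intros z Hz; now apply Cmod_dilatation).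
assert (Nom : forall z, disk z -> (1 + om z)%C <> 0%C) by (intros z Hz; now apply one_plus_neq_0, Hom).
assert (Hg1 : forall z, disk z -> C_derive g z = (om z * C_derive h z)%C).
{ intros z Hz. unfold om. rewrite <- (Hdil z Hz). field.
  (* Clearing the quotient g'/h' requires h' to be nonzero, and the positive Jacobian of f gives
     |g'| < |h'|. *)
  specialize (Hsp z Hz). rewrite (jacobian_of_rep f h g z _ _ Hrep Hz (Dh z Hz) (Dg z Hz)) in Hsp.
  apply Cmod_lt_sqr in Hsp. apply Cmod_gt_0.
  eapply Rle_lt_trans; [apply Cmod_ge_0|exact Hsp]. }
assert (Hh1 : forall z, disk z -> C_derive h z = (1 / (1 - z) / (1 - z) / (1 + om z))%C).
{ intros z Hz. apply (shear_derivative h g om z Hsum); auto. }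
destruct (disk_pseries_shear_derivative n theta Hn12) as [q Hq].
assert (Ph : disk_pseries (coef_int q) h).
{ apply (disk_pseries_of_derive q h (C_derive h)); [|exact Dh|exact h00].
  eapply disk_pseries_ext; [reflexivity| |exact Hq]. intros z Hz. symmetry. now apply Hh1. }
(* The series of g is that of z/(1-z) minus that of h. *)
assert (Pg : exists b, disk_pseries b g).
{ eexists. eapply disk_pseries_ext; [reflexivity| |exact (disk_pseries_plus _ _ _ _
    (disk_pseries_mulz _ _ disk_pseries_geom) (disk_pseries_scal (-1)%C _ _ Ph))].
  intros z Hz. cbv beta. assert (N := disk_neq_1 z Hz).
  replace (g z) with (h z + g z + (-1) * h z)%C by ring. rewrite (Hsum z Hz). field. exact N. }
destruct Pg as [b Pg].
destruct (disk_pseries_derive _ _ (proj1 (disk_pseries_derive _ _ Ph))) as [_ Dh2].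
set (w1 := fun z : C => (expi theta * (INR n * z ^ pred n))%C).
assert (Dom : forall z, Cdiff om z (w1 z)).
{ intros z. unfold om, w1. destruct n as [|m]; [lia|]. apply Cdiff_monomial. }
assert (Hh2 : forall z, disk z -> C_derive (C_derive h) z =
  ((2 * (1 + om z) - w1 z * (1 - z)) / ((1 - z) * (1 - z) * (1 - z) * (1 + om z) * (1 + om z)))%C).
{ intros z Hz. apply (shear_second_derivative (C_derive h) om z); auto. }
assert (Hg2 : forall z, disk z ->
  C_derive (C_derive g) z = (w1 z * C_derive h z + om z * C_derive (C_derive h) z)%C).
{ intros z Hz. apply Cdiff_C_derive.
  apply (Cdiff_ext_disk (fun z => om z * C_derive h z)%C); [|exact Hz|].
  - intros w Hw. symmetry. now apply Hg1.
  - apply Cdiff_mult; [apply Dom|now apply Dh2]. }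
set (H := conv h0 h). set (G := conv g0 g).
assert (DH := fun z => Cdiff_conv_kernel h0 h 1 _ z h0_partial_fractions Ph h00).
assert (DG := fun z => Cdiff_conv_kernel g0 g (-1) _ z g0_partial_fractions Pg g00).
fold H in DH. fold G in DG.
destruct (conv_kernel h0 h 1 _ h0_partial_fractions Ph h00) as [[a PH] EH].
destruct (conv_kernel g0 g (-1) _ g0_partial_fractions Pg g00) as [[c PG] EG].
fold H in PH, EH. fold G in PG, EG.
assert (HF : forall z, disk z -> harmonic_conv h0 g0 h g z = (H z + Cconj (G z))%C) by reflexivity.
assert (He := Cmod_expi theta).
assert (HJ : forall z, disk z ->
  Cmod (/ 2 * (C_derive g z + (-1)%R * (C_derive g z + z * C_derive (C_derive g) z)))%C <
  Cmod (/ 2 * (C_derive h z + 1%R * (C_derive h z + z * C_derive (C_derive h) z)))%C).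
{ intros z Hz. rewrite (Hg2 z Hz), (Hg1 z Hz), (Hh2 z Hz), (Hh1 z Hz).
  exact (convolution_dilatation n (expi theta) z Hn12 He Hz). }
assert (Hconv : convex_in_real_direction (harmonic_conv h0 g0 h g)).
{ apply (shear_disk _ H G _ _ HF DH DG HJ).
  intros z Hz. rewrite (Hg2 z Hz), (Hg1 z Hz), (Hh2 z Hz), (Hh1 z Hz).
  exact (convolution_real_part z (om z) (w1 z) Hz (Hom z Hz)). }
split; [|exact Hconv].
assert (Hom0 : om 0%C = 0%C) by (unfold om; destruct n; [lia|simpl; ring]).
assert (Hh10 : C_derive h 0%C = 1%C).
{ rewrite (Hh1 _ disk_0), Hom0. field. }
destruct (d_z_of_rep _ H G 0%C _ _ HF disk_0 (DH _ disk_0) (DG _ disk_0)) as [Ez Ezb].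
split; [exact (harmonic_of_disk_pseries a c _ H G PH PG HF)|].
split.
{ intros z Hz. rewrite (jacobian_of_rep _ H G z _ _ HF Hz (DH z Hz) (DG z Hz)).
  apply Cmod_lt_sqr, HJ, Hz. }
split; [apply Hconv|]. split; [|split].
- rewrite (HF _ disk_0), (EH _ disk_0), (EG _ disk_0), h00, g00.
  replace (/ 2 * (0 + (-1)%R * (0 * C_derive g 0)))%C with (RtoC 0) by ring.
  apply injective_projections; simpl; ring.
- rewrite Ez, Hh10. field.
- rewrite Ezb, (Hg1 _ disk_0), Hom0.
  replace (/ 2 * _)%C with (RtoC 0) by ring.
  apply injective_projections; simpl; ring.
Qed.
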